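(* (Fractional Poisson summation formula) Let $\alpha\in\mathbb{R}\setminus\pi\mathbb{Z}$. Suppose that $f$ is a continuous function on $\mathbb{R}^n$, that there exist $C,\delta>0$ such that $$|f(x)|\le\frac{C}{(1+|x|)^{n+\delta}},\quad\forall x\in\mathbb{R}^n,$$ and that the fractional Fourier transform $\mathcal{F}_\alpha(e_{-\alpha}f)$ restricted to $\mathbb{Z}^n$ satisfies $$\sum_{m\in\mathbb{Z}^n}\big|\mathcal{F}_\alpha(e_{-\alpha}f)(m)\big|<\infty.$$ Then for all $x\in\mathbb{R}^n$ we have $$\sum_{m\in\mathbb{Z}^n}\mathcal{F}_\alpha(e_{-\alpha}f)(m)K_{-\alpha}(m,x)=e_{-\alpha}(x)\sum_{k\in\mathbb{Z}^n}f(x+k|\sin\alpha|),$$ and in particular $$A_{-\alpha}^n\sum_{m\in\mathbb{Z}^n}\mathcal{F}_\alpha(e_{-\alpha}f)(m)e_{-\alpha}(m)=\sum_{k\in\mathbb{Z}^n}f(k|\sin\alpha|).$$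
   Context: Let $n\ge1$ and $\alpha\in\mathbb{R}\setminus\pi\mathbb{Z}$. For $x\in\mathbb{R}^n$ put $e_\alpha(x)=e^{\pi i|x|^2\cot\alpha}$, $e_{-\alpha}(x)=e^{-\pi i|x|^2\cot\alpha}$, and $(e_{-\alpha}f)(x)=e_{-\alpha}(x)f(x)$. Put $A_\alpha=\sqrt{1-i\cot\alpha}$ (principal branch), $e_\alpha(m,x)=e^{-2\pi i(m\cdot x)\csc\alpha}$ and $K_\alpha(m,x)=A_\alpha^n e_\alpha(x)e_\alpha(m,x)e_\alpha(m)$; $A_{-\alpha}$, $K_{-\alpha}$ are obtained by replacing $\alpha$ by $-\alpha$. For an integrable function $h$ on $\mathbb{R}^n$ the fractional Fourier transform of order $\alpha$ is $\mathcal{F}_\alpha(h)(u)=\int_{\mathbb{R}^n}h(x)K_\alpha(u,x)\,dx$, $u\in\mathbb{R}^n$. *)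

(* Defs.v *)
From HB Require Import structures.
From mathcomp Require Import all_boot all_order all_algebra.
From mathcomp Require Import complex.
From mathcomp Require Import all_classical all_reals all_analysis.

Set Implicit Arguments.
Unset Strict Implicit.
Unset Printing Implicit Defensive.

Import Order.TTheory GRing.Theory Num.Theory.
Import numFieldNormedType.Exports.

Local Open Scope classical_set_scope.
Local Open Scope ring_scope.
Local Open Scope complex_scope.

Notation normc := ComplexField.Normc.normc.

Section LebesgueMeasureRn.
Variable R : realType.

Local Notation Rn n := (n.-tuple (measurableTypeR R)).

Definition tuple_cons n (p : measurableTypeR R * Rn n) : Rn n.+1 :=
  [the n.+1.-tuple (measurableTypeR R) of p.1 :: p.2].

Lemma measurable_tuple_cons n : measurable_fun [set: _] (@tuple_cons n).
Proof.
by apply: measurable_cons; [exact: measurable_fst|exact: measurable_snd].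
Qed.

Definition lebesgue_step n (mu : {measure set (Rn n) -> \bar R}) :
    set (Rn n.+1) -> \bar R :=
  pushforward (lebesgue_measure \x^ mu)%E (@tuple_cons n).

Section lebesgue_step_measure.
Variables (n : nat) (mu : {measure set (Rn n) -> \bar R}).

Let lebesgue_step0 : lebesgue_step mu set0 = 0%E.
Proof. by apply: measure0; exact: measurable_tuple_cons. Qed.

Let lebesgue_step_ge0 A : (0 <= lebesgue_step mu A)%E.
Proof. by apply: measure_ge0; exact: measurable_tuple_cons. Qed.

Let lebesgue_step_sigma_additive : semi_sigma_additive (lebesgue_step mu).
Proof.
by apply: measure_semi_sigma_additive; exact: measurable_tuple_cons.
Qed.

HB.instance Definition _ := isMeasure.Build _ _ _ (lebesgue_step mu)
  lebesgue_step0 lebesgue_step_ge0 lebesgue_step_sigma_additive.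

End lebesgue_step_measure.

(* Lebesgue measure on the Borel sets of R^n, as an iterated product measure;
   on R^0 it is the unit mass at the empty tuple. *)
Fixpoint lebesgue_measure_tuple n : {measure set (Rn n) -> \bar R} :=
  match n return {measure set (Rn n) -> \bar R} with
  | 0 => \d_([tuple] : Rn 0)
  | n'.+1 => lebesgue_step (lebesgue_measure_tuple n')
  end.

End LebesgueMeasureRn.

Section FractionalFourier.
Variables (R : realType) (n : nat).
Implicit Types (x u m : 'rV[R]_n) (alpha : R).

Definition dotrv x u : R := \sum_(i < n) x 0 i * u 0 i.

(* The library norm on 'rV[R]_n is the maximum norm, hence this one. *)
Definition enorm x : R := Num.sqrt (dotrv x x).

Definition rv_of_tuple (t : n.-tuple R) : 'rV[R]_n := \row_i tnth t i.

Definition cintegral (h : 'rV[R]_n -> R[i]) : R[i] :=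
  (\int[lebesgue_measure_tuple R n]_t complex.Re (h (rv_of_tuple t))) +i*
  (\int[lebesgue_measure_tuple R n]_t complex.Im (h (rv_of_tuple t))).

Definition cot alpha : R := cos alpha / sin alpha.
Definition csc alpha : R := (sin alpha)^-1.

Definition expi (t : R) : R[i] := cos t +i* sin t.

Definition chirp alpha x : R[i] := expi (pi * enorm x ^+ 2 * cot alpha).

Definition frac_exp alpha m x : R[i] :=
  expi (- (2 * pi * dotrv m x * csc alpha)).

(* sqrtc is the principal branch, unlike the generic sqrtC, whose values have
   nonnegative imaginary part. *)
Definition frac_amp alpha : R[i] := sqrtc (1 -i* cot alpha).

Definition frac_kernel alpha m x : R[i] :=
  frac_amp alpha ^+ n * chirp alpha x * frac_exp alpha m x * chirp alpha m.

Definition frac_fourier alpha (h : 'rV[R]_n -> R[i]) u : R[i] :=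
  cintegral (fun x => h x * frac_kernel alpha u x).

End FractionalFourier.

Section ComplexSums.
Variables (R : realType) (I : choiceType).

Definition csummable (a : I -> R[i]) : Prop :=
  summable [set: I] (fun i => (normc (a i))%:E).

(* Unordered sum of a real family, as the difference of the sums of its
   positive and negative parts; meaningful for summable families only. *)
Definition rsum (a : I -> R) : R :=
  fine (esum [set: I] (EFin \o a)^\+ - esum [set: I] (EFin \o a)^\-)%E.

Definition csum (a : I -> R[i]) : R[i] :=
  rsum (fun i => complex.Re (a i)) +i* rsum (fun i => complex.Im (a i)).

End ComplexSums.

Definition Zpt (R : realType) (n : nat) (m : 'rV[int]_n) : 'rV[R]_n :=
  map_mx intr m.
Arguments Zpt R {n} m.

Definition frac_coef (R : realType) (n : nat) (alpha : R)
    (f : 'rV[R]_n -> R[i]) (m : 'rV[int]_n) : R[i] :=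
  frac_fourier alpha (fun x => chirp (- alpha) x * f x) (Zpt R m).

(* Main.v *)
From HB Require Import structures.
Require Import Defs.
From mathcomp Require Import all_boot all_order all_algebra.
From mathcomp Require Import complex.
From mathcomp Require Import all_classical all_reals all_analysis.
From mathcomp Require Import measurable_realfun zify ring lra.

(** Multiplying [f] by the chirp of order [- alpha] cancels the chirp of the
    kernel, so the fractional transform at an integer point [m] is a constant
    times a chirp in [m] times the ordinary Fourier transform of [f] at
    [m csc alpha].  In the product with the kernel of order [- alpha] the chirps
    in [m] cancel as well, and the two amplitudes multiply to [1 / |sin alpha|]
    ([frac_ampM], [frac_coef_kernel]).  What remains is the classical Poisson
    formula at the point [x] for the lattice [T Z^n], where [T = |sin alpha|].

    That formula is proved by induction on the dimension ([poisson_tuple]).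
    Freeze the last [n] frequencies [m].  The coefficients at [(j, m)], as [j]
    varies, are those of a function of the first variable alone, and the
    one-dimensional formula turns their sum over [j] into the coefficient at [m]
    of the periodization of [g] in the first variable ([row_sum]).  This
    periodization is a function of [n] variables satisfying the same hypotheses,
    because [(1 + |x|)^-(n + delta)] is at most the product of the integrable
    weights [(1 + |x_i|)^-(1 + delta / n)] ([normc_le_decay]), and products are
    stable under slicing, integration and summation.

    On the line ([poisson_line]) the function is integrated against the Fejer
    kernel of period [T].  Expanding the kernel into waves gives weighted sums of
    the coefficients, with weights between [0] and [1] that tend to [1]; since the
    coefficients are summable, these converge to the full sum
    ([cint_fejer_weights]).  Cutting the line into cells of length [T] centred at
    the points [x + T k], the kernel is nonnegative with mass [T] on each cell and
    concentrates at the centre, so by continuity the integral over the cell tends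
    to [T g(x + T k)] ([cell_mean_cvg]); the decay of [g] allows to sum over [k]
    ([cint_fejer_cvg_lattice]).

    An unordered sum over a countable type is the integral for counting measure
    ([csum_cint]).  Linearity, dominated convergence and Fubini are therefore
    needed only once, for complex-valued integrals, and then apply to integrals,
    to sums, and to interchanges between them. *)

Set Implicit Arguments.
Unset Strict Implicit.
Unset Printing Implicit Defensive.
Import Order.TTheory GRing.Theory Num.Theory.
Import numFieldNormedType.Exports.

Local Open Scope classical_set_scope.
Local Open Scope ring_scope.
Local Open Scope complex_scope.

(** * Countable sums as integrals *)

(** The point [i0] is a parameter because a measurable type must be pointed. *)
Definition discrete_type (I : countType) (i0 : I) : Type := I.
HB.instance Definition _ (I : countType) (i0 : I) :=
  Countable.on (discrete_type i0).
HB.instance Definition _ (I : countType) (i0 : I) :=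
  @isPointed.Build (discrete_type i0) i0.
HB.instance Definition _ (I : countType) (i0 : I) :=
  @isMeasurable.Build default_measure_display (discrete_type i0)
    (@discrete_measurable I) (@discrete_measurable0 I)
    (@discrete_measurableC I) (@discrete_measurableU I).

(** A constant of its own, so that it can carry a sigma-finite structure for
    every countable type. *)
Definition discrete_counting (R : realType) (I : countType) (i0 : I) :
  set (discrete_type i0) -> \bar R := counting.
Arguments discrete_counting R {I} i0.
HB.instance Definition _ (R : realType) (I : countType) (i0 : I) :=
  Measure.copy (discrete_counting R i0) (@counting (discrete_type i0) R).

Section discrete.
Context (R : realType) (I : countType) (i0 : I).
Local Notation cnt := (discrete_counting R i0).
Local Open Scope ereal_scope.

Lemma esum_pickle (a : I -> \bar R) : (forall i, 0 <= a i) ->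
  \esum_(i in [set: I]) a i =
  \sum_(n <oo) (if @pickle_inv I n is Some i then a i else 0).
Proof.
move=> a0.
set b := fun n => if @pickle_inv I n is Some i then a i else 0.
rewrite nneseries_esumT; last by move=> n; rewrite /b; case: pickle_inv.
rewrite (esumID (range (@pickle I))); last by move=> n _; rewrite /b; case: pickle_inv.
rewrite !setTI [X in _ + X]esum1 ?adde0; last first.
  move=> n /= nP; rewrite /b; case E : pickle_inv => [i|//].
  by case: nP; exists i => //; have := @pickle_invK I n; rewrite /= E.
rewrite (@reindex_esum R I nat setT _ (@pickle I)).
  by apply: eq_esum => i _; rewrite /b pickleK_inv.
by split=> // i j _ _ /(pcan_inj (@pickleK_inv I)).
Qed.

Lemma measurable_discrete d (T : measurableType d) (h : discrete_type i0 -> T) D :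
  measurable_fun D h.
Proof. by []. Qed.

Let dir (n : nat) : {measure set (discrete_type i0) -> \bar R} :=
  if @pickle_inv I n is Some i then \d_(i : discrete_type i0) else mzero.

(** Counting measure is the series of the Dirac masses along an enumeration of
    the type, so integrating against it is summing along this enumeration. *)
Lemma integral_discrete (f : I -> \bar R) : (forall i, 0 <= f i) ->
  \int[cnt]_i f i = \esum_(i in [set: I]) f i.
Proof.
move=> f0; rewrite esum_pickle//.
transitivity (\int[mseries dir O]_i f i).
  congr (integral _ _ _); apply/funext => A.
  rewrite /mseries /=.
  transitivity (\esum_(i in [set: I]) (\d_(i : discrete_type i0) A : \bar R)).
    rewrite (esumID A)// setTI setTI.
    rewrite [X in _ = _ + X](_ : _ = 0) ?adde0; last first.
      by apply: esum1 => i Ai; rewrite /= /dirac indicE memNset.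
    rewrite /discrete_counting /counting/=; case: ifPn => /asboolP finA.
      by rewrite -finite_card_dirac.
    by rewrite infinite_card_dirac.
  rewrite esum_pickle//; apply: eq_eseriesr => n _; rewrite /dir.
  by case: pickle_inv.
rewrite (@ge0_integral_measure_series _ _ R dir setT)//=.
apply: eq_eseriesr => n _; rewrite /dir; case: pickle_inv => [i|].
  by rewrite integral_dirac//= diracT mul1e.
by rewrite integral_measure_zero.
Qed.

Lemma sigma_finite_discrete : sigma_finite [set: discrete_type i0] cnt.
Proof.
exists (fun n => [set i : discrete_type i0 | (@pickle I i <= n)%N]).
  by apply/seteqP; split=> // i _; exists (pickle i) => /=.
move=> n; split => //; rewrite /discrete_counting /counting asboolT ?ltry//.
have := finite_II n.+1 => /(@finite_preimage _ _ _ (@pickle I)).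
apply.
by move=> i j _ _ /(pcan_inj (@pickleK I)).
Qed.
HB.instance Definition _ :=
  @Measure_isSigmaFinite.Build _ _ _ (discrete_counting R i0) sigma_finite_discrete.

Lemma rsum_integral (a : I -> R) : rsum a = (\int[cnt]_i a i)%R.
Proof.
rewrite /rsum /Rintegral integralE !integral_discrete//.
Qed.

End discrete.

(** * Complex-valued integrals *)

Section complex_facts.
Context {R : realType}.
Implicit Types z w : R[i].

Lemma ReD z w : complex.Re (z + w) = complex.Re z + complex.Re w.
Proof. by case: z; case: w. Qed.
Lemma ImD z w : complex.Im (z + w) = complex.Im z + complex.Im w.
Proof. by case: z; case: w. Qed.
Lemma ReM z w :
  complex.Re (z * w) = complex.Re z * complex.Re w - complex.Im z * complex.Im w.
Proof. by case: z; case: w. Qed.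
Lemma ImM z w :
  complex.Im (z * w) = complex.Re z * complex.Im w + complex.Im z * complex.Re w.
Proof. by case: z; case: w. Qed.
Lemma Re_sum I (r : seq I) (F : I -> R[i]) :
  complex.Re (\sum_(i <- r) F i) = \sum_(i <- r) complex.Re (F i).
Proof. by elim: r => [|i r IH]; rewrite ?big_nil// !big_cons ReD IH. Qed.
Lemma complex_eq z w : complex.Re z = complex.Re w -> complex.Im z = complex.Im w ->
  z = w.
Proof. by case: z; case: w => ? ? ? ? /= -> ->. Qed.

Lemma normc_ge0 z : 0 <= normc z.
Proof. by case: z => a b; exact: sqrtr_ge0. Qed.

Lemma normcE z : normc z = Num.sqrt (complex.Re z ^+ 2 + complex.Im z ^+ 2).
Proof. by case: z. Qed.

Lemma Re_le_normc z : `|complex.Re z| <= normc z.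
Proof. by rewrite normcE -sqrtr_sqr ler_wsqrtr// lerDl sqr_ge0. Qed.
Lemma Im_le_normc z : `|complex.Im z| <= normc z.
Proof. by rewrite normcE -sqrtr_sqr ler_wsqrtr// lerDr sqr_ge0. Qed.
Lemma normc_le_ReIm z : normc z <= `|complex.Re z| + `|complex.Im z|.
Proof.
rewrite normcE -(ler_pXn2r (n := 2))// ?nnegrE ?sqrtr_ge0 ?addr_ge0//.
rewrite sqr_sqrtr ?addr_ge0 ?sqr_ge0// sqrrD !real_normK ?num_real//.
rewrite addrAC lerDl mulrn_wge0// mulr_ge0//.
Qed.

Lemma normc_real (x : R) : normc x%:C = `|x|.
Proof. by rewrite normcE /= expr0n addr0 sqrtr_sqr. Qed.

Lemma normcX z n : normc (z ^+ n) = normc z ^+ n.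
Proof.
by elim: n => [|n IH]; rewrite ?expr0 ?ComplexField.Normc.normc1// !exprS
  ComplexField.Normc.normcM IH.
Qed.

End complex_facts.

Section complex_integral.
Context d (T : measurableType d) (R : realType).
Implicit Types (h : T -> R[i]) (mu : {measure set T -> \bar R}).

Definition cint (mu : {measure set T -> \bar R}) h : R[i] :=
  (\int[mu]_t complex.Re (h t)) +i* (\int[mu]_t complex.Im (h t)).

Definition cmeasurable h :=
  measurable_fun [set: T] (fun t => complex.Re (h t)) /\
  measurable_fun [set: T] (fun t => complex.Im (h t)).

Definition cintegrable (mu : {measure set T -> \bar R}) h :=
  mu.-integrable setT (EFin \o (fun t => complex.Re (h t))) /\
  mu.-integrable setT (EFin \o (fun t => complex.Im (h t))).

Lemma cmeasurable_cst (c : R[i]) : cmeasurable (fun=> c).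
Proof. by split; exact: measurable_cst. Qed.

Lemma cmeasurableD h1 h2 :
  cmeasurable h1 -> cmeasurable h2 -> cmeasurable (fun t => h1 t + h2 t).
Proof.
move=> [r1 i1] [r2 i2]; split.
  under eq_fun do rewrite ReD; exact: measurable_funD.
under eq_fun do rewrite ImD; exact: measurable_funD.
Qed.

Lemma cmeasurableM h1 h2 :
  cmeasurable h1 -> cmeasurable h2 -> cmeasurable (fun t => h1 t * h2 t).
Proof.
move=> [r1 i1] [r2 i2]; split.
  under eq_fun do rewrite ReM; apply: measurable_funB; exact: measurable_funM.
under eq_fun do rewrite ImM; apply: measurable_funD; exact: measurable_funM.
Qed.

Lemma cmeasurable_sum I (r : seq I) (h : I -> T -> R[i]) :
  (forall i, cmeasurable (h i)) -> cmeasurable (fun t => \sum_(i <- r) h i t).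
Proof.
move=> mh; elim: r => [|i r IH].
  by under eq_fun do rewrite big_nil; exact: cmeasurable_cst.
by under eq_fun do rewrite big_cons; exact: cmeasurableD.
Qed.

Lemma cmeasurable_prod n (h : 'I_n -> T -> R[i]) :
  (forall i, cmeasurable (h i)) -> cmeasurable (fun t => \prod_(i < n) h i t).
Proof.
elim: n h => [|n IH] h mh.
  under eq_fun do rewrite big_ord0; exact: cmeasurable_cst.
under eq_fun do rewrite big_ord_recl.
by apply: cmeasurableM => //; apply: IH => i; exact: mh.
Qed.

Lemma cmeasurable_normc h : cmeasurable h ->
  measurable_fun setT (fun t => normc (h t)).
Proof.
move=> [mr mi]; under eq_fun do rewrite normcE.
apply: (@measurableT_comp _ _ _ _ _ _ (@Num.sqrt R)).
  by apply: continuous_measurable_fun; exact: sqrt_continuous.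
by apply: measurable_funD; exact: measurable_funX.
Qed.

Lemma cmeasurable_cvg (h_ : nat -> T -> R[i]) h :
  (forall n, cmeasurable (h_ n)) ->
  (forall t, complex.Re (h_ n t) @[n --> \oo] --> complex.Re (h t)) ->
  (forall t, complex.Im (h_ n t) @[n --> \oo] --> complex.Im (h t)) ->
  cmeasurable h.
Proof.
move=> mh cr ci; split.
  by apply: (@measurable_fun_cvg _ _ _ _ (fun n t => complex.Re (h_ n t))) => [n|t _];
    [case: (mh n)|exact: cr].
by apply: (@measurable_fun_cvg _ _ _ _ (fun n t => complex.Im (h_ n t))) => [n|t _];
    [case: (mh n)|exact: ci].
Qed.

Lemma cintegrable_cmeasurable mu h : cintegrable mu h -> cmeasurable h.
Proof.
by move=> [/measurable_int/measurable_EFinP ? /measurable_int/measurable_EFinP].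
Qed.

(** Domination is stated on the modulus, the form in which bounds on waves and
    kernels are available. *)
Lemma le_cintegrable mu h (phi : T -> R) : cmeasurable h ->
  (forall t, normc (h t) <= phi t) ->
  mu.-integrable setT (EFin \o phi) -> cintegrable mu h.
Proof.
move=> [mr mi] hphi iphi; split; apply: le_integrable iphi => //.
- exact/measurable_EFinP.
- move=> t _ /=; rewrite lee_fin (le_trans (Re_le_normc _))//.
  exact: le_trans (hphi t) (ler_norm _).
- exact/measurable_EFinP.
- move=> t _ /=; rewrite lee_fin (le_trans (Im_le_normc _))//.
  exact: le_trans (hphi t) (ler_norm _).
Qed.

Lemma integrable_normc mu h : cintegrable mu h ->
  mu.-integrable setT (EFin \o (fun t => normc (h t))).
Proof.
move=> ih; have [ir ii] := ih.
have mh := cintegrable_cmeasurable ih.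
apply: (@le_integrable _ _ _ mu setT measurableT _
  ((abse \o (EFin \o (fun t => complex.Re (h t)))) \+
   (abse \o (EFin \o (fun t => complex.Im (h t)))))%E).
- by apply/measurable_EFinP; exact: cmeasurable_normc.
- move=> t _ /=; rewrite lee_fin ger0_norm ?normc_ge0//.
  by rewrite ger0_norm ?addr_ge0// normc_le_ReIm.
- by apply: integrableD => //; exact: integrable_abse.
Qed.

Lemma eq_cint mu h1 h2 : h1 =1 h2 -> cint mu h1 = cint mu h2.
Proof. by move=> /funext ->. Qed.

Lemma cintD mu h1 h2 : cintegrable mu h1 -> cintegrable mu h2 ->
  cint mu (fun t => h1 t + h2 t) = cint mu h1 + cint mu h2.
Proof.
move=> [r1 i1] [r2 i2]; apply: complex_eq; rewrite ?ReD ?ImD /=.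
  by rewrite -RintegralD//; apply: eq_Rintegral => t _; rewrite ReD.
by rewrite -RintegralD//; apply: eq_Rintegral => t _; rewrite ImD.
Qed.

Lemma cintegrableD mu h1 h2 : cintegrable mu h1 -> cintegrable mu h2 ->
  cintegrable mu (fun t => h1 t + h2 t).
Proof.
move=> [r1 i1] [r2 i2]; split.
  by apply: eq_integrable (integrableD _ r1 r2) => // t _ /=; rewrite ReD.
by apply: eq_integrable (integrableD _ i1 i2) => // t _ /=; rewrite ImD.
Qed.

Lemma cintegrableZl mu c h : cintegrable mu h ->
  cintegrable mu (fun t => c * h t).
Proof.
move=> [r1 i1]; split.
  apply: eq_integrable (integrableB _ (integrableZl _ (complex.Re c) r1)
    (integrableZl _ (complex.Im c) i1)) => // t _ /=.
  by rewrite ReM.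
apply: eq_integrable (integrableD _ (integrableZl _ (complex.Re c) i1)
    (integrableZl _ (complex.Im c) r1)) => // t _ /=.
by rewrite ImM.
Qed.

Lemma cintZl mu c h : cintegrable mu h ->
  cint mu (fun t => c * h t) = c * cint mu h.
Proof.
move=> [r1 i1]; apply: complex_eq; rewrite ?ReM ?ImM /= -!RintegralZl//.
  rewrite -RintegralB//; [|exact: (integrableZl _ _ r1)|exact: (integrableZl _ _ i1)].
  by apply: eq_Rintegral => t _; rewrite ReM.
rewrite -RintegralD//; [|exact: (integrableZl _ _ i1)|exact: (integrableZl _ _ r1)].
by apply: eq_Rintegral => t _; rewrite ImM.
Qed.

Lemma Re_cint mu h : complex.Re (cint mu h) = \int[mu]_t complex.Re (h t).
Proof. by []. Qed.

Lemma Im_cint mu h : complex.Im (cint mu h) = \int[mu]_t complex.Im (h t).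
Proof. by []. Qed.

Lemma cint0 mu : cint mu (fun=> 0) = 0.
Proof.
by rewrite /cint /= /Rintegral integral0.
Qed.

Lemma cintegrable0 mu : cintegrable mu (fun=> 0).
Proof. by split; exact: integrable0. Qed.

Lemma cintegrable_sum mu I (r : seq I) (h : I -> T -> R[i]) :
  (forall i, cintegrable mu (h i)) ->
  cintegrable mu (fun t => \sum_(i <- r) h i t).
Proof.
move=> ih; elim: r => [|i r IH].
  by under eq_fun do rewrite big_nil; exact: cintegrable0.
by under eq_fun do rewrite big_cons; exact: cintegrableD.
Qed.

Lemma cint_sum mu I (r : seq I) (h : I -> T -> R[i]) :
  (forall i, cintegrable mu (h i)) ->
  cint mu (fun t => \sum_(i <- r) h i t) = \sum_(i <- r) cint mu (h i).
Proof.
move=> ih; elim: r => [|i r IH].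
  by under eq_cint do rewrite big_nil; rewrite big_nil cint0.
under eq_cint do rewrite big_cons.
by rewrite big_cons cintD ?IH//; exact: cintegrable_sum.
Qed.

(** The factor 2 comes from bounding the real and imaginary parts separately;
    it is harmless, since the lemma only serves to find dominating functions. *)
Lemma normc_cint_le mu h (phi : T -> R) : cmeasurable h ->
  (forall t, normc (h t) <= phi t) ->
  mu.-integrable setT (EFin \o phi) ->
  normc (cint mu h) <= 2 * \int[mu]_t phi t.
Proof.
move=> mh hphi iphi; have [ir ii] := le_cintegrable mh hphi iphi.
apply: (le_trans (normc_le_ReIm _)) => /=.
have ib (g : T -> R) : mu.-integrable setT (EFin \o g) ->
    (forall t, `|g t| <= normc (h t)) ->
    `|\int[mu]_t g t| <= \int[mu]_t phi t.
  move=> ig gh; apply: (le_trans (le_normr_Rintegral _ ig)) => //.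
  apply: le_Rintegral => //; first exact: (integrable_norm ig).
  by move=> t _; exact: le_trans (gh t) (hphi t).
by rewrite mulrDl !mul1r lerD// ib// => t; [exact: Re_le_normc|exact: Im_le_normc].
Qed.

Lemma cint_dominated_convergence mu (h_ : nat -> T -> R[i]) h (phi : T -> R) :
  (forall n, cmeasurable (h_ n)) ->
  (forall t, complex.Re (h_ n t) @[n --> \oo] --> complex.Re (h t)) ->
  (forall t, complex.Im (h_ n t) @[n --> \oo] --> complex.Im (h t)) ->
  (forall n t, normc (h_ n t) <= phi t) ->
  mu.-integrable setT (EFin \o phi) ->
  complex.Re (cint mu (h_ n)) @[n --> \oo] --> complex.Re (cint mu h) /\
  complex.Im (cint mu (h_ n)) @[n --> \oo] --> complex.Im (cint mu h).
Proof.
move=> mh cr ci hphi iphi.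
have key (g_ : nat -> T -> R) (g : T -> R) :
    (forall n, measurable_fun setT (g_ n)) ->
    (forall t, g_ n t @[n --> \oo] --> g t) ->
    (forall n t, `|g_ n t| <= phi t) ->
    \int[mu]_t g_ n t @[n --> \oo] --> \int[mu]_t g t.
  move=> mg cg gphi.
  have mgl : measurable_fun setT g by apply: (@measurable_fun_cvg _ _ _ _ g_) => // t _.
  have h1 n : measurable_fun setT (EFin \o g_ n) by exact/measurable_EFinP.
  have h2 : measurable_fun setT (EFin \o g) by exact/measurable_EFinP.
  have h3 : {ae mu, forall x, [set: T] x ->
      (EFin \o g_ n) x @[n --> \oo] --> (EFin \o g) x}.
    by apply: aeW => t _; apply: cvg_EFin; [exact: nearW|exact: cg].
  have h4 : {ae mu, forall x n, [set: T] x ->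
      (`|(EFin \o g_ n) x| <= (EFin \o phi) x)%E}.
    by apply: aeW => t n _; rewrite /= lee_fin.
  have [ig _] := dominated_convergence measurableT h1 h2 h3 iphi h4.
  rewrite -(fineK (integrable_fin_num measurableT ig)).
  by move=> /fine_cvgP[].
split; apply: key => //.
- by move=> n; case: (mh n).
- by move=> n t; exact: le_trans (Re_le_normc _) (hphi n t).
- by move=> n; case: (mh n).
- by move=> n t; exact: le_trans (Im_le_normc _) (hphi n t).
Qed.

End complex_integral.

Section complex_fubini.
Context d1 d2 (T1 : measurableType d1) (T2 : measurableType d2) (R : realType).
Variable mu : {sigma_finite_measure set T1 -> \bar R}.
Variable nu : {sigma_finite_measure set T2 -> \bar R}.

Lemma integrable_prod_meas (a : T1 -> R) (b : T2 -> R) :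
  mu.-integrable setT (EFin \o a) -> nu.-integrable setT (EFin \o b) ->
  (mu \x nu)%E.-integrable setT (EFin \o (fun z => a z.1 * b z.2)).
Proof.
move=> ia ib.
have ma : measurable_fun setT a by exact/measurable_EFinP/(measurable_int mu).
have mb : measurable_fun setT b by exact/measurable_EFinP/(measurable_int nu).
apply/integrable12ltyP.
  apply/measurable_EFinP/measurable_funM.
    by apply: measurableT_comp => //; exact: measurable_fst.
  by apply: measurableT_comp => //; exact: measurable_snd.
have /integrableP[_ fa] := integrable_norm ia.
have /integrableP[_ fb] := integrable_norm ib.
under eq_integral => x _.
  under eq_integral => y _ do rewrite /= normrM EFinM.
  rewrite ge0_integralZl//; last by exact/measurable_EFinP/measurableT_comp.
  over.
rewrite /= ge0_integralZr//; first last.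
- by apply: integral_ge0 => y _; rewrite lee_fin.
- by exact/measurable_EFinP/measurableT_comp.
rewrite lte_mul_pinfty//.
- by apply: integral_ge0 => y _; rewrite lee_fin.
- rewrite ge0_fin_numE; last by apply: integral_ge0 => y _; rewrite lee_fin.
  by under eq_integral do rewrite -normr_id.
- by under eq_integral do rewrite -normr_id.
Qed.

Section real.
Variable g : T1 * T2 -> R.
Hypothesis ig : (mu \x nu)%E.-integrable setT (EFin \o g).
Hypothesis ig1 : forall x, nu.-integrable setT (EFin \o (fun y => g (x, y))).

(** With all slices integrable, and not only almost all of them, the inner real
    integral is finite everywhere, so it agrees pointwise with the extended one
    to which Fubini applies. *)
Lemma Rintegral_fubini1 :
  mu.-integrable setT (EFin \o (fun x => \int[nu]_y g (x, y))) /\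
  \int[mu]_x \int[nu]_y g (x, y) = \int[(mu \x nu)%E]_z g z.
Proof.
have E : EFin \o (fun x => \int[nu]_y g (x, y)) = fubini_F nu (EFin \o g).
  apply/funext => x /=; rewrite /Rintegral fineK//.
  exact: (integrable_fin_num _ (ig1 x)).
split; first by rewrite E; exact: integrable_fubini_F.
rewrite /Rintegral; congr fine.
transitivity (\int[mu]_x (fubini_F nu (EFin \o g) x))%E;
  last exact: integral12_prod_meas1.
by apply: eq_integral => x _; rewrite -E.
Qed.

End real.

Section real2.
Variable g : T1 * T2 -> R.
Hypothesis ig : (mu \x nu)%E.-integrable setT (EFin \o g).
Hypothesis ig2 : forall y, mu.-integrable setT (EFin \o (fun x => g (x, y))).

(** The inner integral over the first variable is dominated by that of the
    absolute value, whose integral is finite by Tonelli. *)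
Lemma Rintegral_fubini2 :
  nu.-integrable setT (EFin \o (fun y => \int[mu]_x g (x, y))) /\
  \int[nu]_y \int[mu]_x g (x, y) = \int[(mu \x nu)%E]_z g z.
Proof.
have E : EFin \o (fun y => \int[mu]_x g (x, y)) = fubini_G mu (EFin \o g).
  apply/funext => x /=; rewrite /Rintegral fineK//.
  exact: (integrable_fin_num _ (ig2 x)).
split.
  have mg := measurable_int _ ig.
  have mag : measurable_fun setT (abse \o (EFin \o g)) by exact: measurableT_comp.
  have mG := @measurable_fun_fubini_tonelli_G _ _ _ _ R mu _ mag.
  have Gge0 y : (0 <= fubini_G mu (abse \o (EFin \o g)) y)%E.
    by apply: integral_ge0 => x _; exact: abse_ge0.
  rewrite E; apply: (@le_integrable _ _ _ nu _ measurableT _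
    (fubini_G mu (abse \o (EFin \o g)))).
  - exact: (measurable_fubini_G ig).
  - move=> y _; rewrite [leRHS]gee0_abs//; apply: le_abse_integral => //.
    exact: (measurable_int _ (ig2 y)).
  - apply/integrableP; split; first by apply: mG => ?; exact: abse_ge0.
    under eq_integral do rewrite gee0_abs//.
    by have /integrable21ltyP := ig; exact.
rewrite /Rintegral; congr fine.
transitivity (\int[nu]_x (fubini_G mu (EFin \o g) x))%E;
  last exact: integral21_prod_meas1.
by apply: eq_integral => x _; rewrite -E.
Qed.

End real2.

Variable f : T1 * T2 -> R[i].
Hypothesis fi : cintegrable (mu \x nu)%E f.

Lemma cint_fubini1 : (forall x, cintegrable nu (fun y => f (x, y))) ->
  cintegrable mu (fun x => cint nu (fun y => f (x, y))) /\
  cint mu (fun x => cint nu (fun y => f (x, y))) = cint (mu \x nu)%E f.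
Proof.
case: fi => fr fim f1.
have [r1 r2] := Rintegral_fubini1 fr (fun x => (f1 x).1).
have [i1 i2] := Rintegral_fubini1 fim (fun x => (f1 x).2).
by split=> //; apply: complex_eq.
Qed.

Lemma cint_fubini2 : (forall y, cintegrable mu (fun x => f (x, y))) ->
  cintegrable nu (fun y => cint mu (fun x => f (x, y))) /\
  cint nu (fun y => cint mu (fun x => f (x, y))) = cint (mu \x nu)%E f.
Proof.
case: fi => fr fim f1.
have [r1 r2] := Rintegral_fubini2 fr (fun x => (f1 x).1).
have [i1 i2] := Rintegral_fubini2 fim (fun x => (f1 x).2).
by split=> //; apply: complex_eq.
Qed.

End complex_fubini.

(** * Unordered complex sums *)

Lemma integrable_indic_lty d (T : measurableType d) (R : realType)
    (mu : {measure set T -> \bar R}) (A : set T) : measurable A ->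
  (mu A < +oo)%E -> mu.-integrable setT (EFin \o \1_A).
Proof.
move=> mA Aoo; apply/integrableP; split.
  by apply/measurable_EFinP; exact: measurable_indic.
under eq_integral do rewrite /= ger0_norm//.
by rewrite integral_indic// setIT.
Qed.

Section discrete_sums.
Context (R : realType) (I : countType) (i0 : I).
Local Notation cnt := (discrete_counting R i0).

Lemma csum_cint (a : I -> R[i]) : csum a = cint cnt a.
Proof. by apply: complex_eq => /=; rewrite (rsum_integral i0). Qed.

Lemma csummable_cintegrable (a : I -> R[i]) :
  csummable a <-> cintegrable cnt a.
Proof.
have E : csummable a <-> cnt.-integrable setT (EFin \o (fun i => normc (a i))).
  split.
    move=> sa; apply/integrableP; split; first exact: measurable_discrete.
    by rewrite integral_discrete.
  move=> /integrableP[_]; rewrite integral_discrete//.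
split.
  move=> /E ia.
  by apply: (@le_cintegrable _ (discrete_type i0) _ _ _ (fun i => normc (a i))) => //.
by move=> ih; apply: (iffRL E); exact: integrable_normc.
Qed.

Lemma discrete_counting1 (i : I) : cnt [set i : discrete_type i0] = 1%E.
Proof.
rewrite /discrete_counting /counting; case: asboolP => [_|[]] /=; last first.
  exact: finite_set1.
by rewrite -finite_card_dirac// esum_set1// diracE mem_set.
Qed.

(** This evaluates one coefficient as a sum over all frequencies, which turns
    finite combinations of coefficients into sums with weights. *)
Lemma cint_single (i : I) (c : I -> R[i]) :
  cintegrable cnt (fun j => if j == i then c j else 0) /\
  cint cnt (fun j => if j == i then c j else 0) = c i.
Proof.
have key (r : R) : cnt.-integrable setT
    (EFin \o (fun j : I => if j == i then r else 0)) /\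
    \int[cnt]_j (if j == i then r else 0) = r.
  have E : (fun j : discrete_type i0 => if j == i then r else 0) =
           (fun j => r * \1_[set i : discrete_type i0] j).
    apply/funext => j; rewrite indicE; case: eqP => [->|ne].
      by rewrite mem_set// mulr1.
    by rewrite memNset ?mulr0.
  have ii : cnt.-integrable setT
      (EFin \o \1_[set i : discrete_type i0]).
    by apply: integrable_indic_lty => //; rewrite [X in (X < _)%E]discrete_counting1 ltry.
  rewrite E; split.
    exact: (integrableZl _ r ii).
  rewrite RintegralZl// /Rintegral integral_indic// setIT.
  by rewrite [X in fine X]discrete_counting1 mulr1.
have E : (fun j => if j == i then c j else 0) = (fun j => if j == i then c i else 0).
  by apply/funext => j; case: eqP => [->|].
rewrite E.
have Er j : complex.Re (if j == i then c i else 0) =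
            if j == i then complex.Re (c i) else 0 by case: ifP.
have Ei j : complex.Im (if j == i then c i else 0) =
            if j == i then complex.Im (c i) else 0 by case: ifP.
split.
  split; under [X in integrable _ _ (_ \o X)]eq_fun do rewrite ?Er ?Ei.
    by have [] := key (complex.Re (c i)).
  by have [] := key (complex.Im (c i)).
apply: complex_eq => /=.
  by under eq_Rintegral do rewrite Er; have [] := key (complex.Re (c i)).
by under eq_Rintegral do rewrite Ei; have [] := key (complex.Im (c i)).
Qed.

(** The preimage of a set is the countable union of its slices, each times a
    point. *)
Lemma measurable_fun_discrete_prod d (T : measurableType d) d'
    (S : measurableType d') (f : discrete_type i0 * T -> S) :
  (forall i, measurable_fun setT (fun t => f (i, t))) ->
  measurable_fun setT f.
Proof.
move=> mf _ B mB; rewrite setTI.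
have -> : f @^-1` B = \bigcup_n (if @pickle_inv I n is Some i then
    [set i : discrete_type i0] `*` ((fun t => f (i, t)) @^-1` B) else set0).
  apply/seteqP; split=> [[i t] /= Bf|[i t] [n _]].
    by exists (pickle i) => //; rewrite pickleK_inv.
  by case: pickle_inv => // j [/= -> ].
apply: bigcupT_measurable => n; case: pickle_inv => [i|//].
apply: measurableX => //.
by rewrite -[X in measurable X]setTI; exact: mf.
Qed.

Lemma cmeasurable_discrete_prod d (T : measurableType d)
    (f : discrete_type i0 * T -> R[i]) :
  (forall i, cmeasurable (fun t => f (i, t))) -> cmeasurable f.
Proof.
move=> mf; split; apply: measurable_fun_discrete_prod => i.
  by case: (mf i).
by case: (mf i).
Qed.

End discrete_sums.

Section csum_reindex.
Context (R : realType) (I J : choiceType) (e : I -> J).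
Hypothesis be : bijective e.

Let seb : set_bij [set: I] [set: J] e.
Proof.
case: be => f ef fe; split => //; first by move=> x y _ _ /(can_inj ef).
by move=> y _; exists (f y).
Qed.

Lemma reindex_csum (a : J -> R[i]) : csum a = csum (a \o e).
Proof.
have key (b : J -> R) : rsum b = rsum (b \o e).
  rewrite /rsum !(@reindex_esum _ _ _ _ _ _ _ seb).
  by congr (fine (_ - _)%E); apply: eq_esum => i _; rewrite ?funeposE ?funenegE.
by apply: complex_eq => /=; rewrite key.
Qed.

Lemma reindex_csummable (a : J -> R[i]) : csummable a <-> csummable (a \o e).
Proof. by rewrite /csummable /summable (@reindex_esum _ _ _ _ _ _ _ seb). Qed.

End csum_reindex.

(** * Complex exponentials *)

Section expi_facts.
Context {R : realType}.
Implicit Types t u : R.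

Lemma ReZ (r : R) (z : R[i]) : complex.Re (r%:C * z) = r * complex.Re z.
Proof. by rewrite ReM /= mul0r subr0. Qed.
Lemma ImZ (r : R) (z : R[i]) : complex.Im (r%:C * z) = r * complex.Im z.
Proof. by rewrite ImM /= mul0r addr0. Qed.

Lemma expiD t u : expi (t + u) = expi t * expi u.
Proof.
apply: complex_eq; rewrite /= ?ReM ?ImM /= ?cosD ?sinD// addrC mulrC.
by congr (_ + _); rewrite mulrC.
Qed.

Lemma expi0 : expi 0 = 1 :> R[i].
Proof. by rewrite /expi cos0 sin0. Qed.

Lemma normc_expi t : normc (expi t) = 1.
Proof. by rewrite normcE /= cos2Dsin2 sqrtr1. Qed.

Lemma expiN t : expi (- t) = (expi t)^*.
Proof. by rewrite /expi cosN sinN. Qed.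

Lemma expi_sum I (r : seq I) (F : I -> R) :
  expi (\sum_(i <- r) F i) = \prod_(i <- r) expi (F i).
Proof. by elim: r => [|i r IH]; rewrite ?big_nil ?expi0// !big_cons expiD IH. Qed.

Lemma sinD2pi_int t (j : int) : sin (t + j%:~R * (2 * pi)) = sin t.
Proof.
have key (n : nat) u : sin (u + n%:R * (2 * pi)) = sin u.
  by rewrite mulr_natl [2 * pi]mulr_natl (periodicn (@sinD2pi R)).
case: (intP j) => [|n|n]; first by rewrite mul0r addr0.
  exact: key.
by rewrite -[in RHS](subrK (n.+1%:R * (2 * pi)) t) mulrNz mulNr key.
Qed.

Lemma integral_cos (a b c d : R) : c != 0 -> a < b ->
  \int[lebesgue_measure]_(y in `[a, b[) cos (c * y + d) =
  (sin (c * b + d) - sin (c * a + d)) / c.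
Proof.
move=> c0 ab.
have dlin y : is_derive y (1:R) (fun y => c * y + d) c.
  have -> : (fun y => c * y + d) = (c \*: id) + cst d by [].
  by apply: is_derive_eq; rewrite addr0 /GRing.scale /= mulr1.
have dF y : is_derive y (1:R) (fun y => c^-1 * sin (c * y + d)) (cos (c * y + d)).
  have -> : (fun y => c^-1 * sin (c * y + d)) =
     c^-1 \*: (sin \o (fun y => c * y + d)) by [].
  apply: is_derive_eq; rewrite /GRing.scale /=; field.
  exact: c0.
have cf : continuous (fun y : R => cos (c * y + d)).
  move=> y; apply: continuous_comp; last exact: continuous_cos.
  by apply: cvgD; [apply: cvgM; [exact: cvg_cst|exact: cvg_id]|exact: cvg_cst].
have cF : continuous (fun y : R => c^-1 * sin (c * y + d)).
  move=> y; apply/differentiable_continuous/derivable1_diffP.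
  by case: (dF y).
rewrite Rintegral_itv_bndo_bndc; last first.
  apply: integrableS (continuous_compact_integrable (@segment_compact _ a b) _) => //.
    exact: subset_itv_co_cc.
  exact: continuous_subspaceT.
rewrite /Rintegral (@continuous_FTC2 _ _ (fun y => c^-1 * sin (c * y + d)))//.
- by rewrite -EFinB /= -mulrBr mulrC.
- exact: continuous_subspaceT.
- split.
  + by move=> y _; case: (dF y).
  + by apply: cvg_at_right_filter; exact: cF.
  + by apply: cvg_at_left_filter; exact: cF.
- by move=> y _; rewrite derive1E; apply: derive_val.
Qed.

End expi_facts.


(** * Waves, cells and the Fejer kernel *)

Section fejer_kernel.
Context {R : realType}.
Variables (T : R) (x : R).
Hypothesis T0 : 0 < T.
Implicit Types (j k : int) (y : R) (N : nat).
Local Notation leb := (@lebesgue_measure R).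

(** The phase is centred at [x], so that the sum of the coefficients of a
    function is its Fourier series at the point [x]. *)
Definition wave j y : R[i] := expi (- (2 * pi * (j%:~R * (y - x)) / T)).

Lemma waveD i j y : wave (i + j) y = wave i y * wave j y.
Proof. by rewrite -expiD /wave intrD; congr expi; field; rewrite gt_eqF. Qed.

Lemma waveN j y : wave (- j) y = (wave j y)^*.
Proof. by rewrite -expiN /wave rmorphN; congr expi; field; rewrite gt_eqF. Qed.

Lemma wave0 y : wave 0 y = 1.
Proof. by rewrite /wave mul0r mulr0 mul0r oppr0 expi0. Qed.

Lemma wave_nat (n : nat) y : wave n y = wave 1 y ^+ n.
Proof.
elim: n => [|n IH]; first by rewrite wave0 expr0.
by rewrite -addn1 PoszD waveD IH exprD.
Qed.

Lemma normc_wave j y : normc (wave j y) = 1.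
Proof. exact: normc_expi. Qed.

Lemma waveE j y :
  complex.Re (wave j y) = cos (- (2 * pi * j%:~R / T) * y + 2 * pi * j%:~R / T * x) /\
  complex.Im (wave j y) = sin (- (2 * pi * j%:~R / T) * y + 2 * pi * j%:~R / T * x).
Proof.
rewrite /wave /=.
suff -> : - (2 * pi * (j%:~R * (y - x)) / T) =
  - (2 * pi * j%:~R / T) * y + 2 * pi * j%:~R / T * x by [].
by field; rewrite gt_eqF.
Qed.

Lemma cmeasurable_wave j : cmeasurable (wave j : measurableTypeR R -> R[i]).
Proof.
have mlin : measurable_fun [set: measurableTypeR R]
    (fun y : R => - (2 * pi * (j%:~R * (y - x)) / T)).
  apply: continuous_measurable_fun => y.
  apply: cvgN; apply: cvgM; last exact: cvg_cst.
  apply: cvgM; first exact: cvg_cst.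
  apply: cvgM; first exact: cvg_cst.
  by apply: cvgB; [exact: cvg_id|exact: cvg_cst].
split.
  apply: (@measurableT_comp _ _ _ _ _ _ (@cos R)) => //.
  by apply: continuous_measurable_fun; exact: continuous_cos.
apply: (@measurableT_comp _ _ _ _ _ _ (@sin R)) => //.
by apply: continuous_measurable_fun; exact: continuous_sin.
Qed.

(** Half-open, so that the cells partition the line. *)
Definition cell k : set R :=
  `[x + T * k%:~R - T / 2, x + T * k%:~R + T / 2[%classic.

Lemma cellP k y : cell k y <-> k = Num.floor ((y - x) / T + 2^-1).
Proof.
have E1 : (x + T * k%:~R - T / 2 <= y) = (k%:~R <= (y - x) / T + 2^-1).
  rewrite -lerBlDr ler_pdivlMr// mulrBl; apply/idP/idP; lra.
have E2 : (y < x + T * k%:~R + T / 2) = ((y - x) / T + 2^-1 < (k + 1)%:~R).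
  rewrite -ltrBrDr ltr_pdivrMr// intrD; apply/idP/idP; lra.
rewrite /cell /= in_itv /= E1 E2; split.
  by move=> h; apply/esym/floor_def.
by move=> ->; rewrite floor_le_tmp lt_succ_floor.
Qed.

Lemma measurable_cell k : measurable (cell k : set (measurableTypeR R)).
Proof. exact: measurable_itv. Qed.

Lemma lebesgue_cell k : leb (cell k) = T%:E.
Proof.
rewrite /cell lebesgue_measure_itv /= lte_fin ifT; last first.
  by rewrite ltrD2l gtrN// divr_gt0.
rewrite -EFinB; congr EFin; by field.
Qed.

Lemma integrable_indic_cell k : leb.-integrable setT (EFin \o \1_(cell k)).
Proof.
apply: integrable_indic_lty; first exact: measurable_cell.
by rewrite [X in (X < _)%E]lebesgue_cell ltry.
Qed.

Lemma integrable_cell_dom k (h : measurableTypeR R -> R) (M : R) :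
  measurable_fun setT h -> (forall y, cell k y -> `|h y| <= M) ->
  leb.-integrable setT (EFin \o (fun y => \1_(cell k) y * h y)).
Proof.
move=> mh hM.
apply: (@le_integrable _ _ _ leb setT measurableT _
  (fun y => (M%:E * (EFin \o \1_(cell k)) y)%E)); last first.
- exact: integrableZl (integrable_indic_cell k).
- move=> y _ /=; rewrite lee_fin indicE; case: (boolP (y \in cell k)) => yc.
    by rewrite mul1r mulr1 (le_trans (hM _ (set_mem yc)))// ler_norm.
  by rewrite mul0r mulr0 normr0.
- apply/measurable_EFinP/measurable_funM => //.
  exact: measurable_indic (measurable_cell k).
Qed.

Lemma cintegrable_cell_wave k j :
  cintegrable leb (fun y => (\1_(cell k) y)%:C * wave j y).
Proof.
have [mr mi] := cmeasurable_wave j.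
split.
  under [X in integrable _ _ (_ \o X)]eq_fun do rewrite ReZ.
  apply: (@integrable_cell_dom _ _ 1) => // y _.
  by rewrite (le_trans (Re_le_normc _))// normc_wave.
under [X in integrable _ _ (_ \o X)]eq_fun do rewrite ImZ.
apply: (@integrable_cell_dom _ _ 1) => // y _.
by rewrite (le_trans (Im_le_normc _))// normc_wave.
Qed.

(** A cell has length [T], which is a whole number of periods of each wave. *)
Lemma cint_cell_wave k j :
  cint leb (fun y => (\1_(cell k) y)%:C * wave j y) = if j == 0 then T%:C else 0.
Proof.
have restr (h : R -> R) : \int[leb]_y (\1_(cell k) y * h y) =
    \int[leb]_(y in cell k) h y.
  rewrite [RHS]Rintegral_mkcond; apply: eq_Rintegral => y _.
  rewrite indicE patchE; case: ifP => _; rewrite ?mul1r ?mul0r//.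
apply: complex_eq.
  rewrite Re_cint; under eq_Rintegral do rewrite ReZ.
  rewrite restr; case: eqP => [->|/eqP j0].
    under eq_Rintegral do rewrite wave0.
    by rewrite Rintegral_cst ?mul1r ?[X in fine X]lebesgue_cell//; exact: measurable_cell.
  under eq_Rintegral do rewrite (waveE j _).1.
  rewrite integral_cos; last 2 first.
  - by rewrite oppr_eq0 !mulf_neq0 ?invr_eq0 ?intr_eq0 ?(gt_eqF (pi_gt0 R)) ?(gt_eqF T0).
  - by rewrite ltrD2l gtrN// divr_gt0.
  rewrite [X in sin X - _](_ : _ = (- (2 * pi * j%:~R / T) * (x + T * k%:~R - T / 2) +
     2 * pi * j%:~R / T * x) + (- j)%:~R * (2 * pi)).
    by rewrite sinD2pi_int subrr mul0r.
  by rewrite rmorphN; field; rewrite gt_eqF.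
rewrite Im_cint; under eq_Rintegral do rewrite ImZ.
rewrite restr; case: eqP => [->|/eqP j0].
  under eq_Rintegral do rewrite wave0.
  by rewrite Rintegral_cst ?mul0r//; exact: measurable_cell.
under eq_Rintegral do rewrite (waveE j _).2 -cosBpihalf -addrA.
rewrite integral_cos; last 2 first.
- by rewrite oppr_eq0 !mulf_neq0 ?invr_eq0 ?intr_eq0 ?(gt_eqF (pi_gt0 R)) ?(gt_eqF T0).
- by rewrite ltrD2l gtrN// divr_gt0.
rewrite [X in sin X - _](_ : _ = (- (2 * pi * j%:~R / T) * (x + T * k%:~R - T / 2) +
   (2 * pi * j%:~R / T * x - pi / 2)) + (- j)%:~R * (2 * pi)).
  by rewrite sinD2pi_int subrr mul0r.
by rewrite rmorphN; field; rewrite gt_eqF.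
Qed.

(** The Fejer kernel as a square, which makes it visibly nonnegative; its
    expansion into waves is [fejerE]. *)
Definition fejer N y : R := N.+1%:R^-1 * normc (\sum_(a < N.+1) wave a y) ^+ 2.

Lemma fejer_ge0 N y : 0 <= fejer N y.
Proof. by rewrite mulr_ge0// exprn_ge0// normc_ge0. Qed.

Lemma fejerE N y : (fejer N y)%:C =
  (N.+1%:R^-1)%:C * \sum_(a < N.+1) \sum_(b < N.+1) wave (a%:Z - b%:Z) y.
Proof.
rewrite /fejer rmorphM; congr (_ * _).
set z := \sum_(a < N.+1) wave a y.
transitivity (z * z^*).
  case: z => u v; rewrite normcE sqr_sqrtr ?addr_ge0 ?sqr_ge0//.
  by apply: complex_eq => /=; ring.
rewrite [X in _ * X]rmorph_sum mulr_suml; apply: eq_bigr => a _.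
by rewrite mulr_sumr; apply: eq_bigr => b _; rewrite waveD waveN.
Qed.

Lemma cmeasurable_fejer N : cmeasurable (fun y : measurableTypeR R => (fejer N y)%:C).
Proof.
under eq_fun do rewrite fejerE.
apply: cmeasurableM; first exact: cmeasurable_cst.
by apply: cmeasurable_sum => a; apply: cmeasurable_sum => b; exact: cmeasurable_wave.
Qed.

Lemma measurable_fejer N : measurable_fun [set: measurableTypeR R] (fejer N).
Proof. by case: (cmeasurable_fejer N). Qed.

(** This is the square of [|1 - wave 1 y|]: it vanishes exactly at the points
    [x + T k] and measures the distance to them. *)
Definition wave_gap y : R := 2 - 2 * cos (2 * pi * (y - x) / T).

(** The sum in the kernel is geometric, so multiplying it by [1 - wave 1 y]
    leaves [1 - wave (N + 1) y], of modulus at most 2. All that is needed on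
    the concentration of the kernel is contained in this bound. *)
Lemma wave_gap_fejer N y : wave_gap y * fejer N y <= 4 / N.+1%:R.
Proof.
rewrite /fejer mulrCA [leRHS]mulrC ler_pM2l ?invr_gt0//.
have -> : wave_gap y = normc (1 - wave 1 y) ^+ 2.
  rewrite normcE sqr_sqrtr ?addr_ge0 ?sqr_ge0// /wave /= mul1r cosN sinN.
  rewrite ?add0r ?opprK.
  have := cos2Dsin2 (2 * pi * (y - x) / T).
  rewrite /wave_gap; lra.
rewrite -exprMn -ComplexField.Normc.normcM.
have -> : (1 - wave 1 y) * (\sum_(a < N.+1) wave a y) = 1 - wave 1 y ^+ N.+1.
  rewrite -[in RHS](expr1n _ N.+1) subrXX; congr (_ * _).
  by apply: eq_bigr => a _; rewrite expr1n mul1r wave_nat.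
rewrite (_ : 4 = 2 ^+ 2); last by rewrite -natrX.
rewrite lerXn2r ?nnegrE ?normc_ge0//.
apply: (le_trans (le_normcD _ _)).
by rewrite normcN normcX normc_wave expr1n ComplexField.Normc.normc1.
Qed.

(** Among the waves [a - b] in the expansion only the [N + 1] diagonal ones
    have a nonzero integral over the cell. *)
Lemma integral_cell_fejer k N :
  leb.-integrable setT (EFin \o (fun y => \1_(cell k) y * fejer N y)) /\
  \int[leb]_y (\1_(cell k) y * fejer N y) = T.
Proof.
have E y : (\1_(cell k) y * fejer N y)%:C = (N.+1%:R^-1)%:C *
  \sum_(a < N.+1) \sum_(b < N.+1) ((\1_(cell k) y)%:C * wave (a%:Z - b%:Z) y).
  rewrite rmorphM /= fejerE mulrCA; congr (_ * _); rewrite mulr_sumr.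
  by apply: eq_bigr => a _; rewrite mulr_sumr.
have i1 (a : 'I_N.+1) : cintegrable leb (fun y =>
    \sum_(b < N.+1) ((\1_(cell k) y)%:C * wave (a%:Z - b%:Z) y)).
  by apply: cintegrable_sum => b; exact: cintegrable_cell_wave.
have i2 : cintegrable leb (fun y =>
    \sum_(a < N.+1) \sum_(b < N.+1) ((\1_(cell k) y)%:C * wave (a%:Z - b%:Z) y)).
  exact: cintegrable_sum.
split.
  have [h _] : cintegrable leb (fun y => (\1_(cell k) y * fejer N y)%:C).
    by under eq_fun do rewrite E; exact: cintegrableZl.
  exact: h.
have -> : \int[leb]_y (\1_(cell k) y * fejer N y) =
    complex.Re (cint leb (fun y => (\1_(cell k) y * fejer N y)%:C)) by [].
under eq_cint do rewrite E.
rewrite cintZl// cint_sum//.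
rewrite (_ : \sum_(a < N.+1) _ = \sum_(a < N.+1) T%:C); last first.
  apply: eq_bigr => a _; rewrite cint_sum; last first.
    by move=> b; exact: cintegrable_cell_wave.
  rewrite (bigD1 a)//= cint_cell_wave subrr eqxx big1 ?addr0// => b ba.
  rewrite cint_cell_wave subr_eq0 ifF//.
  by apply/negbTE; apply: contra ba => /eqP [?]; apply/eqP/val_inj.
rewrite ReZ Re_sum /= sumr_const card_ord -[T *+ _]mulr_natl.
by rewrite mulrA mulVf ?mul1r.
Qed.

End fejer_kernel.

(** * Poisson summation on the line *)

Section fejer_weights.
Context {R : realType}.

(** Equal to [max(0, 1 - |m| / (N + 1))], but written as the count of pairs
    that the expansion of the Fejer kernel produces. *)
Definition fejer_weight N (m : int) : R :=
  N.+1%:R^-1 * \sum_(a < N.+1) \sum_(b < N.+1) (m == a%:Z - b%:Z)%:R.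

Lemma fejer_weight_ge0 N m : 0 <= fejer_weight N m.
Proof.
by rewrite mulr_ge0//; apply: sumr_ge0 => a _; apply: sumr_ge0 => b _.
Qed.

Lemma fejer_weightN N m : fejer_weight N (- m) = fejer_weight N m.
Proof.
rewrite /fejer_weight exchange_big; congr (_ * _).
apply: eq_bigr => a _; apply: eq_bigr => b _.
by rewrite -eqr_opp opprK opprB.
Qed.

(** Each row [a] contains at most one [b] with [a - b = m]. *)
Lemma fejer_weight_le1 N m : fejer_weight N m <= 1.
Proof.
rewrite ler_pdivrMl// mulr1.
rewrite (_ : N.+1%:R = \sum_(a < N.+1) 1); last by rewrite sumr_const card_ord.
apply: ler_sum => a _.
have [[b0 hb]|nb] := pselect (exists b0 : 'I_N.+1, m = a%:Z - b0%:Z).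
  rewrite (bigD1 b0)//= -hb eqxx big1 ?addr0// => b bb0.
  rewrite hb; case: eqP => // /addrI /oppr_inj [] /val_inj e.
  by rewrite e eqxx in bb0.
rewrite big1// => b _; case: eqP => // e; case: nb; by exists b.
Qed.

(** The rows [a >= n] contain the solution [b = a - n], so at most [n] of the
    [N + 1] rows are empty. *)
Lemma fejer_weight_ge N (n : nat) : 1 - n%:R / N.+1%:R <= fejer_weight N n.
Proof.
rewrite /fejer_weight ler_pdivlMl// mulrBr mulr1 mulrC divfK ?pnatr_eq0//.
rewrite lerBlDr.
have cnt_le : \sum_(a < N.+1) ((a < n)%N : nat) = minn N.+1 n.
  elim: N => [|N IH]; first by rewrite big_ord_recl big_ord0 /=; case: ltnP; lia.
  by rewrite big_ord_recr /= IH; case: ltnP; lia.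
have -> : N.+1%:R = \sum_(a < N.+1) 1 :> R by rewrite sumr_const card_ord.
apply: (@le_trans _ _ (\sum_(a < N.+1)
   ((\sum_(b < N.+1) (n%:Z == a%:Z - b%:Z)%:R) + (a < n)%N%:R))).
  apply: ler_sum => a _; case: ltnP => [_|na].
    by rewrite lerDr; apply: sumr_ge0.
  rewrite addr0.
  have bN : (a - n < N.+1)%N by rewrite (leq_ltn_trans (leq_subr _ _)).
  rewrite (bigD1 (Ordinal bN))//= -[leLHS]addr0 lerD//; last exact: sumr_ge0.
  rewrite -subzn// opprB addrCA subrr addr0 eqxx//.
rewrite big_split /= lerD2l -natr_sum ler_nat cnt_le; lia.
Qed.

Lemma fejer_weight_cvg m : fejer_weight N m @[N --> \oo] --> (1 : R).
Proof.
wlog [n ->] : m / exists n : nat, m = n.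
  move=> wl; case: (leP 0 m) => [m0|m0].
    by apply: wl; exists `|m|%N; rewrite gez0_abs.
  under eq_cvg do rewrite -fejer_weightN.
  by apply: wl; exists `|m|%N; rewrite lez0_abs// ltW.
have c1 : (fun N : nat => 1 - n%:R * (N.+1%:R^-1)) @ \oo --> (1 : R) - n%:R * 0.
  apply: cvgB; first exact: cvg_cst.
  by apply: cvgM; [exact: cvg_cst|exact: cvg_harmonic].
rewrite mulr0 subr0 in c1.
apply: (@squeeze_cvgr _ _ _ _ (fun N : nat => 1 - n%:R * (N.+1%:R^-1)) (cst 1)).
- by apply: nearW => N; rewrite fejer_weight_ge fejer_weight_le1.
- exact: c1.
- exact: cvg_cst.
Qed.

End fejer_weights.


Lemma normc_dist {R : realType} (z w : R[i]) :
  `|complex.Re z - complex.Re w| <= normc (z - w) /\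
  `|complex.Im z - complex.Im w| <= normc (z - w).
Proof.
have := Re_le_normc (z - w); have := Im_le_normc (z - w).
by case: z w => ? ? [? ?].
Qed.

Section wave_gap_bound.
Context {R : realType}.
Variables (T x : R).
Hypothesis T0 : 0 < T.

Lemma cosD2pi_int (t : R) (j : int) : cos (t + j%:~R * (2 * pi)) = cos t.
Proof. by rewrite -!sinDpihalf addrAC sinD2pi_int. Qed.

Lemma cell_dist k y : cell T x k y -> `|y - (x + T * k%:~R)| <= T / 2.
Proof.
rewrite /cell /= in_itv /= => /andP[h1 h2].
by rewrite ler_norml; apply/andP; split; lra.
Qed.

Lemma wave_gap_ge0 y : 0 <= wave_gap T x y.
Proof. by rewrite /wave_gap; have := cos_le1 (2 * pi * (y - x) / T); lra. Qed.

(** By periodicity the gap depends on the distance to the centre of the cell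
    only, and the cosine decreases over a half period. *)
Lemma wave_gap_away (delta : R) : 0 < delta -> exists2 q0 : R, 0 < q0 &
  forall k y, cell T x k y -> delta <= `|y - (x + T * k%:~R)| ->
    q0 <= wave_gap T x y.
Proof.
move=> d0; pose d' := Num.min delta (T / 2).
have d'0 : 0 < d' by rewrite lt_min d0 divr_gt0.
have d'T : d' <= T / 2 by rewrite ge_min lexx orbT.
pose v := 2 * pi * d' / T.
have v0 : 0 < v by rewrite divr_gt0// mulr_gt0// mulr_gt0// pi_gt0.
have Upi u : u <= T / 2 -> 2 * pi * u / T <= pi.
  move=> uT; rewrite ler_pdivrMr//.
  have -> : pi * T = 2 * pi * (T / 2) by field.
  by rewrite ler_wpM2l// mulr_ge0// pi_ge0.
have vpi : v <= pi by exact: Upi.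
have mem u : 0 <= u <= pi -> u \in `[0, pi] by rewrite in_itv.
exists (2 - 2 * cos v).
  have : cos v < cos 0.
    by rewrite ltr_cos// ?mem// ?lexx ?pi_ge0// (ltW v0).
  by rewrite cos0; lra.
move=> k y yk dy; rewrite /wave_gap.
set u := 2 * pi * `|y - (x + T * k%:~R)| / T.
have -> : cos (2 * pi * (y - x) / T) = cos u.
  have -> : 2 * pi * (y - x) / T =
      2 * pi * (y - (x + T * k%:~R)) / T + k%:~R * (2 * pi).
    by field; rewrite gt_eqF.
  rewrite cosD2pi_int -cos_norm normrM normrM normfV (gtr0_norm T0).
  by rewrite (@gtr0_norm _ (2 * pi))// mulr_gt0// pi_gt0.
have vu : v <= u.
  rewrite ler_pM2r ?invr_gt0// ler_pM2l ?mulr_gt0 ?pi_gt0//.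
  by rewrite ge_min dy.
suff : cos u <= cos v by lra.
move: vu; rewrite le_eqVlt => /orP[/eqP ->//|vu].
have upi : u <= pi by apply: Upi; exact: cell_dist.
have mu : u \in `[0, pi] by apply: mem; rewrite upi (le_trans (ltW v0) (ltW vu)).
have mv : v \in `[0, pi] by apply: mem; rewrite vpi (ltW v0).
by apply/ltW; rewrite ltr_cos.
Qed.

End wave_gap_bound.

Section poisson_line.
Context {R : realType}.
Variables (T x : R) (phi : measurableTypeR R -> R) (K : R).
Hypothesis T0 : 0 < T.
Hypothesis phi_ge0 : forall y, 0 <= phi y.
Local Notation leb := (@lebesgue_measure R).
Hypothesis phi_int : leb.-integrable setT (EFin \o phi).
Hypothesis phi_slow : forall y z, `|y - z| <= T -> phi y <= K * phi z.
Variables (g : measurableTypeR R -> R[i]) (M : R).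
Hypothesis M0 : 0 <= M.
Hypothesis g_re : continuous (fun y : R => complex.Re (g y)).
Hypothesis g_im : continuous (fun y : R => complex.Im (g y)).
Hypothesis g_dom : forall y, normc (g y) <= M * phi y.
Local Notation xk k := (x + T * k%:~R).
Local Notation cell := (cell T x).
Local Notation fejer := (fejer T x).

Let Z := discrete_type (0 : int).
Let cnt := discrete_counting R (0 : int).

Lemma cell_center k : cell k (xk k).
Proof.
by rewrite /cell /= in_itv /= ltrDl gerBl divr_gt0// divr_ge0// ltW.
Qed.

Lemma phi_cell_le k y : cell k y -> phi y <= K * phi (xk k).
Proof.
move=> /cell_dist h; apply: phi_slow; apply: (le_trans h).
by rewrite ler_pdivrMr// ler_peMr// ?ltW//; lra.
Qed.

Lemma phi_center_le k y : cell k y -> phi (xk k) <= K * phi y.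
Proof.
move=> /cell_dist h; apply: phi_slow; rewrite distrC; apply: (le_trans h).
by rewrite ler_pdivrMr// ler_peMr// ?ltW//; lra.
Qed.

Lemma cmeasurable_g : cmeasurable g.
Proof. by split; apply: continuous_measurable_fun. Qed.

(** Near the centre continuity makes the difference small; elsewhere in the
    cell the gap is bounded below, so a large multiple of it dominates. In this
    form the estimate can be integrated against the kernel without splitting
    the cell, thanks to [wave_gap_fejer]. *)
Lemma near_center k (e : R) : 0 < e -> exists2 B : R, 0 <= B &
  forall y, cell k y -> normc (g y - g (xk k)) <= e + B * wave_gap T x y.
Proof.
move=> e0.
have e2 : 0 < e / 2 by rewrite divr_gt0.
have /(@cvgrPdist_lt _ _ _ _ _ (fun y => complex.Re (g y))) /(_ _ e2) := @g_re (xk k).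
move=> /nbhs_ballP[d1 d10 /= h1].
have /(@cvgrPdist_lt _ _ _ _ _ (fun y => complex.Im (g y))) /(_ _ e2) := @g_im (xk k).
move=> /nbhs_ballP[d2 d20 /= h2].
pose d := Num.min d1 d2.
have d0 : 0 < d by rewrite lt_min d10 d20.
have [q0 q00 hq] := wave_gap_away x T0 d0.
(* [W] bounds the function on the whole cell, centre included. *)
pose W := M * (K * phi (xk k)).
have gW y : cell k y -> normc (g y) <= W.
  move=> yk; apply: (le_trans (g_dom _)); rewrite ler_wpM2l//.
  exact: phi_cell_le.
have W0 : 0 <= W by apply: le_trans (gW _ (cell_center k)); exact: normc_ge0.
have Bq : 0 <= 2 * W / q0 by apply: divr_ge0; [exact: mulr_ge0|exact: ltW].
exists (2 * W / q0) => //.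
move=> y yk; have [yd|yd] := ltP `|y - xk k| d.
  apply: (@le_trans _ _ e); last first.
    by rewrite lerDl mulr_ge0 ?wave_gap_ge0.
  apply: (le_trans (normc_le_ReIm _)); rewrite [leRHS](splitr e).
  have dd1 : d <= d1 by rewrite /d ge_min lexx.
  have dd2 : d <= d2 by rewrite /d ge_min lexx orbT.
  have b1 : ball (xk k) d1 y.
    by rewrite -ball_normE /ball_ /= distrC; exact: lt_le_trans yd dd1.
  have b2 : ball (xk k) d2 y.
    by rewrite -ball_normE /ball_ /= distrC; exact: lt_le_trans yd dd2.
  have i1 := h2 _ b2; have i2 := h1 _ b1; apply: lerD.
    by move: i2; rewrite distrC; case: (g y) (g (xk k)) => ? ? [? ?] /= /ltW.
  by move: i1; rewrite distrC; case: (g y) (g (xk k)) => ? ? [? ?] /= /ltW.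
apply: (@le_trans _ _ (2 * W)).
  apply: (le_trans (le_normcD _ _)); rewrite normcN mulrDl !mul1r lerD// gW//.
  exact: cell_center.
apply: (@le_trans _ _ (2 * W / q0 * wave_gap T x y)); last by rewrite lerDr ltW.
have q1 : 1 <= q0^-1 * wave_gap T x y.
  by rewrite mulrC ler_pdivlMr// mul1r; exact: hq yd.
by rewrite -mulrA ler_peMr// mulr_ge0.
Qed.

Definition cell_mean k N : R[i] :=
  cint leb (fun y => (\1_(cell k) y * fejer N y)%:C * g y).

Lemma cmeasurable_cell_mean k N :
  cmeasurable (fun y : measurableTypeR R => (\1_(cell k) y * fejer N y)%:C * g y).
Proof.
apply: cmeasurableM; last exact: cmeasurable_g.
split => /=; last exact: measurable_cst.
apply: measurable_funM; last exact: measurable_fejer.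
exact: measurable_indic (measurable_cell _ _ _).
Qed.

Lemma normc_cell_term k N y :
  normc ((\1_(cell k) y * fejer N y)%:C * g y) <=
  M * K * phi (xk k) * (\1_(cell k) y * fejer N y).
Proof.
have F0 := fejer_ge0 T x N y.
rewrite ComplexField.Normc.normcM normc_real indicE.
case: (boolP (y \in cell k)) => [/set_mem yk|_]; last by rewrite mul0r normr0 mul0r mulr0.
rewrite mul1r ger0_norm// mulrC ler_wpM2r//.
by rewrite -mulrA (le_trans (g_dom _))// ler_wpM2l// phi_cell_le.
Qed.

Lemma cintegrable_cell_mean k N :
  cintegrable leb (fun y => (\1_(cell k) y * fejer N y)%:C * g y).
Proof.
apply: (@le_cintegrable _ _ _ leb _ (fun y =>
  M * K * phi (xk k) * (\1_(cell k) y * fejer N y))).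
- exact: cmeasurable_cell_mean.
- by move=> y; exact: normc_cell_term.
- exact: (integrableZl _ (M * K * phi (xk k)) (integral_cell_fejer x T0 k N).1).
Qed.

Lemma normc_cell_mean k N : normc (cell_mean k N) <= 2 * M * K * T * phi (xk k).
Proof.
have [ii ie] := integral_cell_fejer x T0 k N.
apply: le_trans (normc_cint_le (cmeasurable_cell_mean k N) (normc_cell_term k N) _) _.
  exact: (integrableZl _ (M * K * phi (xk k)) ii).
by rewrite RintegralZl// ie le_eqVlt; apply/orP; left; apply/eqP; ring.
Qed.

(** The kernel has mass [T] on the cell, so the difference is the mean of [g y
    - g (x + T k)], to which [near_center] applies. *)
Lemma cell_mean_error k (e : R) : 0 < e -> exists B : R, forall N,
  normc (cell_mean k N - T%:C * g (xk k)) <= e + B / N.+1%:R.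
Proof.
move=> e0; have e2 : 0 < e / (2 * T) by rewrite divr_gt0// mulr_gt0.
have [B B0 hB] := near_center k e2.
exists (8 * B * T) => N.
have [ii ie] := integral_cell_fejer x T0 k N.
have E : T%:C * g (xk k) = cint leb (fun y => g (xk k) * (\1_(cell k) y * fejer N y)%:C).
  rewrite cintZl; last by split=> //; exact: integrable0.
  rewrite mulrC; congr (_ * _); apply: complex_eq => /=; first by rewrite ie.
  by rewrite /Rintegral integral0.
have iE : cintegrable leb (fun y => (- g (xk k)) * (\1_(cell k) y * fejer N y)%:C).
  by apply: cintegrableZl; split=> //; exact: integrable0.
have E' : cell_mean k N - T%:C * g (xk k) =
    cint leb (fun y => (\1_(cell k) y * fejer N y)%:C * (g y - g (xk k))).
  rewrite E -mulN1r -cintZl; last by apply: cintegrableZl; split=> //; exact: integrable0.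
  rewrite -cintD; last 2 first.
  - exact: cintegrable_cell_mean.
  - by apply: cintegrableZl; apply: cintegrableZl; split=> //; exact: integrable0.
  by apply: eq_cint => y; rewrite mulN1r mulrC -mulrBl mulrC.
rewrite E'.
(* The first term has integral [e / 2]; the second one uses
   [wave_gap_fejer]. *)
pose psi y := e / (2 * T) * (\1_(cell k) y * fejer N y) +
              (4 * B / N.+1%:R) * \1_(cell k) y.
have ipsi1 : leb.-integrable setT
    (EFin \o (fun y => e / (2 * T) * (\1_(cell k) y * fejer N y))).
  exact: (integrableZl _ (e / (2 * T)) ii).
have ipsi2 : leb.-integrable setT (EFin \o (fun y => (4 * B / N.+1%:R) * \1_(cell k) y)).
  exact: (integrableZl _ (4 * B / N.+1%:R) (integrable_indic_cell x T0 k)).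
have ipsi : leb.-integrable setT (EFin \o psi).
  exact: (integrableD _ ipsi1 ipsi2).
have le_psi y : normc ((\1_(cell k) y * fejer N y)%:C * (g y - g (xk k))) <= psi y.
  rewrite /psi ComplexField.Normc.normcM normc_real indicE.
  case: (boolP (y \in cell k)) => [/set_mem yk|_]; last first.
    by rewrite mul0r normr0 !(mul0r, mulr0) addr0.
  have F0 := fejer_ge0 T x N y.
  rewrite mul1r ger0_norm// mulr1.
  apply: (le_trans (ler_wpM2l F0 (hB _ yk))).
  rewrite mulrDr [X in X + _ <= _]mulrC lerD2l.
  have -> : fejer N y * (B * wave_gap T x y) = B * (wave_gap T x y * fejer N y) by ring.
  rewrite [leRHS](_ : _ = B * (4 / N.+1%:R)); last by ring.
  by rewrite ler_wpM2l// wave_gap_fejer.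
have mterm : cmeasurable (fun y : measurableTypeR R =>
    (\1_(cell k) y * fejer N y)%:C * (g y - g (xk k))).
  apply: cmeasurableM.
    split => /=; last exact: measurable_cst.
    apply: measurable_funM; last exact: measurable_fejer.
    exact: measurable_indic (measurable_cell _ _ _).
  apply: cmeasurableD; first exact: cmeasurable_g.
  exact: cmeasurable_cst.
apply: le_trans (normc_cint_le mterm le_psi ipsi) _.
rewrite /psi RintegralD// RintegralZl// ie.
rewrite RintegralZl//; last exact: integrable_indic_cell.
have -> : \int[leb]_y \1_(cell k) y = T.
  rewrite /Rintegral integral_indic//; last exact: measurable_cell.
  by rewrite setIT [X in fine X]lebesgue_cell.
rewrite le_eqVlt; apply/orP; left; apply/eqP; field.
by rewrite gt_eqF//= gt_eqF.
Qed.

Lemma cell_mean_cvg k :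
  complex.Re (cell_mean k N) @[N --> \oo] --> complex.Re (T%:C * g (xk k)) /\
  complex.Im (cell_mean k N) @[N --> \oo] --> complex.Im (T%:C * g (xk k)).
Proof.
have key (e : R) : 0 < e ->
    \forall N \near \oo, normc (cell_mean k N - T%:C * g (xk k)) <= e.
  move=> e0; have e2 : 0 < e / 2 by rewrite divr_gt0.
  have [B hB] := cell_mean_error k e2.
  have : (fun N : nat => B * (N.+1%:R^-1)) @ \oo --> B * 0.
    by apply: cvgM; [exact: cvg_cst|exact: cvg_harmonic].
  rewrite mulr0 => /cvgrPdist_le /(_ _ e2); apply: filterS => N /= hN.
  apply: (le_trans (hB N)); rewrite [leRHS](splitr e) lerD2l.
  by apply: le_trans hN; rewrite sub0r normrN ler_norm.
split; apply/cvgrPdist_le => e /key; apply: filterS => N hN; rewrite distrC;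
  apply: le_trans hN.
  exact: (normc_dist _ _).1.
exact: (normc_dist _ _).2.
Qed.

Lemma cell_single (y : R) (h : R[i]) :
  cintegrable cnt (fun k => (\1_(cell k) y)%:C * h) /\
  cint cnt (fun k => (\1_(cell k) y)%:C * h) = h.
Proof.
have E : (fun k => (\1_(cell k) y)%:C * h) =
    (fun k => if k == Num.floor ((y - x) / T + 2^-1) then h else 0).
  apply/funext => k; rewrite indicE; case: eqP => [kE|nk].
    by rewrite mem_set ?mul1r//; apply/(cellP x T0).
  by rewrite memNset ?mul0r// => /(cellP x T0).
by rewrite E; exact: (@cint_single R _ (0 : int) _ (fun=> h)).
Qed.

(** Summing over the cells first gives back [|h|], because each point is in
    exactly one cell. *)
Lemma integrable_prod_cell (h : measurableTypeR R -> R) :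
  leb.-integrable setT (EFin \o h) ->
  (cnt \x leb)%E.-integrable setT
    (EFin \o (fun z : Z * measurableTypeR R => \1_(cell z.1) z.2 * h z.2)).
Proof.
move=> ih.
have mh : measurable_fun setT h.
  by have /measurable_EFinP := measurable_int leb ih.
apply/integrable21ltyP.
  apply/measurable_EFinP; apply: measurable_fun_discrete_prod => k /=.
  apply: measurable_funM; last exact: mh.
  exact: measurable_indic (measurable_cell _ _ _).
have /integrableP[_] := ih; apply: le_lt_trans.
rewrite le_eqVlt; apply/orP; left; apply/eqP; apply: eq_integral => y _.
have [[ic _] cE] := cell_single y (`|h y|)%:C.
have rE : \int[cnt]_k (\1_(cell k) y * `|h y|) = `|h y|.
  transitivity (complex.Re (cint cnt (fun k => (\1_(cell k) y)%:C * (`|h y|)%:C))).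
    by rewrite Re_cint; apply: eq_Rintegral => k _; rewrite ReZ.
  by rewrite cE.
have ic' : cnt.-integrable setT (EFin \o (fun k => \1_(cell k) y * `|h y|)).
  by apply: eq_integrable ic => // k _; rewrite /comp ReZ.
transitivity ((\int[cnt]_k (\1_(cell k) y * `|h y|))%:E); last by rewrite rE.
rewrite /Rintegral fineK; last first.
  exact: (integrable_fin_num _ ic').
apply: eq_integral => k _ /=; congr EFin.
by rewrite normrM indicE; case: (_ \in _); rewrite ?normr1 ?normr0.
Qed.

(** The value of [phi] at the centre is at most [K] times its values on the
    cell, hence at most [K / T] times its integral over the cell, and the cells
    partition the line. *)
Lemma integrable_phi_lattice : cnt.-integrable setT (EFin \o (fun k => phi (xk k))).
Proof.
have ip := integrable_prod_cell phi_int.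
have islice k : leb.-integrable setT (EFin \o (fun y => \1_(cell k) y * phi y)).
  apply: (@le_integrable _ _ _ leb setT measurableT _ (EFin \o phi)) => //.
    apply/measurable_EFinP; apply: measurable_funM.
      exact: measurable_indic (measurable_cell _ _ _).
    by have /measurable_EFinP := measurable_int leb phi_int.
  move=> y _ /=; rewrite lee_fin normrM ler_piMl//.
  by rewrite indicE; case: (_ \in _); rewrite ?normr1 ?normr0.
have [i1 _] := Rintegral_fubini1 ip islice.
apply: (@le_integrable _ Z R cnt setT measurableT
  (EFin \o (fun k : Z => phi (xk k)))
  (EFin \o (fun k : Z => K / T * \int[leb]_y (\1_(cell k) y * phi y)))).
- exact: measurable_discrete.
- move=> k _ /=; rewrite lee_fin ger0_norm// (le_trans _ (ler_norm _))//.
  rewrite mulrAC ler_pdivlMr// -RintegralZl//.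
  have -> : phi (xk k) * T = \int[leb]_y (phi (xk k) * \1_(cell k) y).
    rewrite RintegralZl//; last exact: integrable_indic_cell.
    rewrite /Rintegral integral_indic//; last exact: measurable_cell.
    by rewrite setIT [X in fine X]lebesgue_cell.
  apply: le_Rintegral => //.
  + exact: (integrableZl _ (phi (xk k)) (integrable_indic_cell x T0 k)).
  + exact: (integrableZl _ K (islice k)).
  move=> y _; rewrite indicE; case: (boolP (y \in cell k)) => [/set_mem yk|_].
    by rewrite mulr1 mul1r phi_center_le.
  by rewrite mul0r !mulr0.
- exact: (integrableZl _ (K / T) i1).
Qed.

Lemma fejer_le N y : fejer N y <= N.+1%:R.
Proof.
rewrite /fejer ler_pdivrMl// -expr2 lerXn2r ?nnegrE ?normc_ge0//.
have le_sum n : normc (\sum_(a < n) wave T x a y) <= n%:R.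
  elim: n => [|n IH]; first by rewrite big_ord0 ComplexField.Normc.normc0.
  rewrite big_ord_recr /= (le_trans (le_normcD _ _))// normc_wave.
  by rewrite -natr1 lerD2r.
exact: le_sum.
Qed.

Lemma cint_fejer_cells N :
  cint leb (fun y => (fejer N y)%:C * g y) = cint cnt (fun k => cell_mean k N).
Proof.
pose f (z : Z * measurableTypeR R) : R[i] := (\1_(cell z.1) z.2 * fejer N z.2)%:C * g z.2.
have Mphi : leb.-integrable setT (EFin \o (fun y => N.+1%:R * M * phi y)).
  exact: (integrableZl _ (N.+1%:R * M) phi_int).
have fi : cintegrable (cnt \x leb)%E f.
  apply: (@le_cintegrable _ _ _ _ _ (fun z : Z * measurableTypeR R =>
    \1_(cell z.1) z.2 * (N.+1%:R * M * phi z.2))).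
  - by apply: cmeasurable_discrete_prod => k; exact: cmeasurable_cell_mean.
  - move=> [k y]; rewrite /f ComplexField.Normc.normcM normc_real /= indicE.
    case: (_ \in _); last by rewrite !mul0r normr0 mul0r.
    rewrite !mul1r ger0_norm ?fejer_ge0// -mulrA ler_pM ?fejer_ge0 ?normc_ge0//.
    exact: fejer_le.
  - exact: integrable_prod_cell Mphi.
have f1 k : cintegrable leb (fun y => f (k, y)) by exact: cintegrable_cell_mean.
have fE y k : f (k, y) = (\1_(cell k) y)%:C * ((fejer N y)%:C * g y).
  by rewrite /f /= rmorphM mulrA.
have f2 y : cintegrable cnt (fun k => f (k, y)).
  by under eq_fun do rewrite fE; have [] := cell_single y ((fejer N y)%:C * g y).
have [_ E1] := cint_fubini1 fi f1.
have [_ E2] := cint_fubini2 fi f2.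
rewrite [RHS]E1 -E2; apply: eq_cint => y.
under eq_cint do rewrite fE.
by have [_ ->] := cell_single y ((fejer N y)%:C * g y).
Qed.

Lemma cint_fejer_cvg_lattice :
  complex.Re (cint leb (fun y => (fejer N y)%:C * g y)) @[N --> \oo] -->
    complex.Re (cint cnt (fun k => T%:C * g (xk k))) /\
  complex.Im (cint leb (fun y => (fejer N y)%:C * g y)) @[N --> \oo] -->
    complex.Im (cint cnt (fun k => T%:C * g (xk k))).
Proof.
under eq_cvg do rewrite cint_fejer_cells.
under [X in _ /\ (X @ _ --> _)]funext do rewrite cint_fejer_cells.
apply: (@cint_dominated_convergence _ Z _ cnt _ _ (fun k => 2 * M * K * T * phi (xk k))).
- by move=> N; split; exact: measurable_discrete.
- by move=> k; have [] := cell_mean_cvg k.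
- by move=> k; have [] := cell_mean_cvg k.
- by move=> N k; exact: normc_cell_mean.
- exact: (integrableZl _ (2 * M * K * T) integrable_phi_lattice).
Qed.

Lemma cintegrable_lattice : cintegrable cnt (fun k => g (xk k)).
Proof.
apply: (@le_cintegrable _ Z _ cnt _ (fun k => M * phi (xk k))).
- by split; exact: measurable_discrete.
- by move=> k; exact: g_dom.
- exact: (integrableZl _ M integrable_phi_lattice).
Qed.

Definition line_coef (j : int) : R[i] := cint leb (fun y => g y * wave T x j y).

Lemma cintegrable_line_coef j : cintegrable leb (fun y => g y * wave T x j y).
Proof.
apply: (@le_cintegrable _ _ _ _ _ (fun y => M * phi y)).
- by apply: cmeasurableM; [exact: cmeasurable_g|exact: cmeasurable_wave].
- by move=> y; rewrite ComplexField.Normc.normcM normc_wave mulr1.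
- exact: (integrableZl _ M phi_int).
Qed.

(** Expand the kernel into waves and group the pairs with equal difference. *)
Lemma cint_fejer_weights N : cintegrable cnt line_coef ->
  cint leb (fun y => (fejer N y)%:C * g y) =
  cint cnt (fun m => (fejer_weight N m)%:C * line_coef m).
Proof.
move=> ic.
have E1 y : (fejer N y)%:C * g y = (N.+1%:R^-1)%:C *
    \sum_(a < N.+1) \sum_(b < N.+1) (g y * wave T x (a%:Z - b%:Z) y).
  rewrite fejerE// -mulrA; congr (_ * _); rewrite mulr_suml.
  by apply: eq_bigr => a _; rewrite mulr_suml; apply: eq_bigr => b _; rewrite mulrC.
under eq_cint do rewrite E1.
have iw (j : int) := cintegrable_line_coef j.
rewrite cintZl; last by do 2! (apply: cintegrable_sum => ?).
rewrite cint_sum; last by move=> a; apply: cintegrable_sum => b.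
have E2 (m : Z) : (fejer_weight N m)%:C * line_coef m = (N.+1%:R^-1)%:C *
    \sum_(a < N.+1) \sum_(b < N.+1) (if m == a%:Z - b%:Z then line_coef m else 0).
  move: (line_coef m) => c.
  rewrite /fejer_weight rmorphM -mulrA; congr (_ * _).
  rewrite rmorph_sum mulr_suml; apply: eq_bigr => a _.
  rewrite rmorph_sum mulr_suml; apply: eq_bigr => b _.
  by case: eqP => _; rewrite ?rmorph1 ?rmorph0 ?mul1r ?mul0r.
under [RHS]eq_cint do rewrite E2.
have is1 (j : int) := (@cint_single R _ (0 : int) j line_coef).1.
rewrite [RHS]cintZl; last by apply: cintegrable_sum => a; apply: cintegrable_sum => b.
rewrite [in RHS]cint_sum; last by move=> a; apply: cintegrable_sum => b.
congr (_ * _); apply: eq_bigr => a _.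
rewrite cint_sum// [in RHS]cint_sum//; apply: eq_bigr => b _.
by rewrite (@cint_single R _ (0 : int) (a%:Z - b%:Z) line_coef).2.
Qed.

(** Both sides are limits of the integrals of [g] against the Fejer kernels,
    computed in frequency on the left and in space on the right. *)
Theorem poisson_line : cintegrable cnt line_coef ->
  cint cnt line_coef = T%:C * cint cnt (fun k => g (xk k)).
Proof.
move=> ic; rewrite -cintZl; last exact: cintegrable_lattice.
have [r1 i1] := cint_fejer_cvg_lattice.
have cw m (r : R) : fejer_weight N m * r @[N --> \oo] --> r.
  rewrite -{2}[r]mul1r; apply: cvgM; last exact: cvg_cst.
  exact: fejer_weight_cvg.
have [r2 i2] : complex.Re (cint leb (fun y => (fejer N y)%:C * g y)) @[N --> \oo] -->
    complex.Re (cint cnt line_coef) /\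
  complex.Im (cint leb (fun y => (fejer N y)%:C * g y)) @[N --> \oo] -->
    complex.Im (cint cnt line_coef).
  under eq_cvg do rewrite cint_fejer_weights//.
  under [X in _ /\ (X @ _ --> _)]funext do rewrite cint_fejer_weights//.
  apply: (@cint_dominated_convergence _ Z _ cnt _ _ (fun m => normc (line_coef m))).
  - by move=> N; split; exact: measurable_discrete.
  - move=> m; rewrite [X in nbhs X](_ : _ =
      (fun N => fejer_weight N m * complex.Re (line_coef m)) @ \oo);
      first exact: cw.
    by congr (_ @ \oo); apply/funext => N; rewrite ReZ.
  - move=> m; rewrite [X in nbhs X](_ : _ =
      (fun N => fejer_weight N m * complex.Im (line_coef m)) @ \oo);
      first exact: cw.
    by congr (_ @ \oo); apply/funext => N; rewrite ImZ.
  - move=> N m; rewrite ComplexField.Normc.normcM normc_real.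
    by rewrite ger0_norm ?fejer_weight_ge0// ler_piMl ?normc_ge0// fejer_weight_le1.
  - exact: integrable_normc.
by apply: complex_eq; [exact: cvg_unique r2 r1|exact: cvg_unique i2 i1].
Qed.

End poisson_line.

(** * Fubini along a change of variables and Lebesgue measure on tuples *)

Section transfer.
Context d1 d2 d3 (T1 : measurableType d1) (T2 : measurableType d2)
  (T3 : measurableType d3) (R : realType).
Variable mu : {sigma_finite_measure set T1 -> \bar R}.
Variable nu : {sigma_finite_measure set T2 -> \bar R}.
Variable la : {measure set T3 -> \bar R}.
Variable c : T1 * T2 -> T3.
Hypothesis mc : measurable_fun setT c.
(* The measure [la] is the image of the product measure; this is used for the
   insertion of a first entry into a tuple, both of reals and of integers. *)
Hypothesis lac : forall f : T3 -> \bar R, measurable_fun setT f ->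
  (forall z, 0 <= f z)%E -> (\int[la]_z f z = \int[mu \x nu]_w f (c w))%E.

Lemma integrable_transfer (f : T3 -> R) : measurable_fun setT f ->
  la.-integrable setT (EFin \o f) <->
  (mu \x nu)%E.-integrable setT (EFin \o (f \o c)).
Proof.
move=> mf.
have mE : measurable_fun setT (EFin \o f) by exact/measurable_EFinP.
have E : (\int[la]_z `|(EFin \o f) z| = \int[mu \x nu]_w `|(EFin \o (f \o c)) w|)%E.
  by rewrite lac//; exact: measurableT_comp.
split=> /integrableP[_ h]; apply/integrableP; split=> //.
- by apply/measurable_EFinP; exact: measurableT_comp.
- by rewrite -E.
- by rewrite E.
Qed.

Lemma Rintegral_transfer (f : T3 -> R) : measurable_fun setT f ->
  \int[la]_z f z = \int[(mu \x nu)%E]_w f (c w).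
Proof.
move=> mf; rewrite /Rintegral integralE [in RHS]integralE.
have mE : measurable_fun setT (EFin \o f) by exact/measurable_EFinP.
rewrite (lac (measurable_funepos mE))// (lac (measurable_funeneg mE))//.
congr (fine (_ - _)%E); apply: eq_integral => w _.
  by rewrite !funeposE.
by rewrite !funenegE.
Qed.

Lemma cintegrable_transfer (f : T3 -> R[i]) : cmeasurable f ->
  cintegrable la f <-> cintegrable (mu \x nu)%E (fun w => f (c w)).
Proof.
move=> [mr mi]; split=> -[h1 h2]; split.
- exact: (integrable_transfer mr).1 h1.
- exact: (integrable_transfer mi).1 h2.
- exact: (integrable_transfer mr).2 h1.
- exact: (integrable_transfer mi).2 h2.
Qed.

Lemma cint_transfer (f : T3 -> R[i]) : cmeasurable f ->
  cint la f = cint (mu \x nu)%E (fun w => f (c w)).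
Proof. by move=> [mr mi]; apply: complex_eq => /=; rewrite Rintegral_transfer. Qed.

Lemma integrable_transfer_prod (a : T1 -> R) (b : T2 -> R) (f : T3 -> R) :
  measurable_fun setT f ->
  mu.-integrable setT (EFin \o a) -> nu.-integrable setT (EFin \o b) ->
  (forall x y, f (c (x, y)) = a x * b y) ->
  la.-integrable setT (EFin \o f).
Proof.
move=> mf ia ib fE; apply/integrable_transfer => //.
rewrite (_ : EFin \o (f \o c) = EFin \o (fun z => a z.1 * b z.2)).
  exact: integrable_prod_meas.
by apply/funext => -[x y] /=; rewrite fE.
Qed.

Lemma cint_transfer_fubini1 (f : T3 -> R[i]) : cintegrable la f ->
  (forall x, cintegrable nu (fun y => f (c (x, y)))) ->
  cintegrable mu (fun x => cint nu (fun y => f (c (x, y)))) /\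
  cint la f = cint mu (fun x => cint nu (fun y => f (c (x, y)))).
Proof.
move=> fi fs; have mf := cintegrable_cmeasurable fi.
have fi' := (cintegrable_transfer mf).1 fi.
by have [i1 e1] := cint_fubini1 fi' fs; rewrite cint_transfer.
Qed.

Lemma cint_transfer_fubini2 (f : T3 -> R[i]) : cintegrable la f ->
  (forall y, cintegrable mu (fun x => f (c (x, y)))) ->
  cintegrable nu (fun y => cint mu (fun x => f (c (x, y)))) /\
  cint la f = cint nu (fun y => cint mu (fun x => f (c (x, y)))).
Proof.
move=> fi fs; have mf := cintegrable_cmeasurable fi.
have fi' := (cintegrable_transfer mf).1 fi.
by have [i1 e1] := cint_fubini2 fi' fs; rewrite cint_transfer.
Qed.

End transfer.

Section sigma_finite_copy.
Context d (T : measurableType d) (R : realType) (mu : {measure set T -> \bar R}).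
Hypothesis mu_sf : sigma_finite [set: T] mu.

(** The proof is an argument of the constant, so that the structure it yields
    is found by unification. *)
Definition sigma_finite_copy : set T -> \bar R := let _ := mu_sf in mu.

Let copy0 : sigma_finite_copy set0 = 0%E. Proof. exact: measure0. Qed.
Let copy_ge0 A : (0 <= sigma_finite_copy A)%E. Proof. exact: measure_ge0. Qed.
Let copy_additive : semi_sigma_additive sigma_finite_copy.
Proof. exact: measure_semi_sigma_additive. Qed.

HB.instance Definition _ := isMeasure.Build _ _ _ sigma_finite_copy
  copy0 copy_ge0 copy_additive.

HB.instance Definition _ := @Measure_isSigmaFinite.Build _ _ _ sigma_finite_copy mu_sf.

End sigma_finite_copy.

Section tuple_measure.
Context (R : realType).
Local Notation Rn n := (n.-tuple (measurableTypeR R)).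
Local Notation leb := (@lebesgue_measure R).

(** Integrating sections in either order gives the same product measure; the
    measure on tuples is built with one order, the Fubini lemmas above use the
    other. *)
Lemma product_measure2_1 d1 d2 (T1 : measurableType d1) (T2 : measurableType d2)
    (m1 : {sigma_finite_measure set T1 -> \bar R})
    (m2 : {sigma_finite_measure set T2 -> \bar R}) (A : set (T1 * T2)) :
  measurable A -> (m1 \x^ m2)%E A = (m1 \x m2)%E A.
Proof.
move=> mA; apply/esym; apply: product_measure_unique => // B C mB mC.
exact: product_measure2E.
Qed.

Lemma sigma_finite_prod d1 d2 (T1 : measurableType d1) (T2 : measurableType d2)
    (m1 : {sigma_finite_measure set T1 -> \bar R})
    (m2 : {sigma_finite_measure set T2 -> \bar R}) :
  exists2 F : (set (T1 * T2))^nat, \bigcup_k F k = setT &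
    forall k, measurable (F k) /\ ((m1 \x m2)%E (F k) < +oo)%E.
Proof.
have [F FT Fm] := sigma_finiteT m1; have [G GT Gm] := sigma_finiteT m2.
exists (fun n => if unpickle n is Some ij then F (ij : nat * nat).1 `*` G ij.2 else set0).
  apply/seteqP; split=> // -[x y] _.
  have [i _ Fx] : (\bigcup_i F i) x by rewrite -FT.
  have [j _ Gy] : (\bigcup_i G i) y by rewrite -GT.
  by exists (pickle (i, j)) => //; rewrite pickleK.
move=> n; case: unpickle => [[i j] /=|]; last by rewrite measure0.
have [mF Foo] := Fm i; have [mG Goo] := Gm j; split; first exact: measurableX.
by rewrite product_measure1E// lte_mul_pinfty// ge0_fin_numE.
Qed.

Definition tuple_uncons n (t : Rn n.+1) : measurableTypeR R * Rn n :=
  (thead t, [tuple of behead t]).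

Lemma tuple_consK n (p : measurableTypeR R * Rn n) :
  tuple_uncons (tuple_cons p) = p.
Proof.
case: p => s t; rewrite /tuple_uncons /tuple_cons /= theadE; congr pair.
exact/val_inj.
Qed.

Lemma measurable_tuple_uncons n : measurable_fun setT (@tuple_uncons n).
Proof.
apply/measurable_fun_pairP; split.
  exact: (@measurable_tnth _ _ n.+1 ord0).
exact: measurable_behead.
Qed.

Lemma sigma_finite_lebesgue_tuple n :
  sigma_finite [set: Rn n] (lebesgue_measure_tuple R n).
Proof.
elim: n => [|n IH].
  exists (fun=> setT); first by rewrite bigcup_const.
  by move=> i; split => //=; rewrite diracE ltry.
pose nu : {sigma_finite_measure set (Rn n) -> \bar R} := sigma_finite_copy IH.
have [F FT Fm] := sigma_finite_prod leb nu.
exists (fun k => @tuple_uncons n @^-1` F k).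
  by rewrite -preimage_bigcup FT preimage_setT.
move=> k; have [mF Ffin] := Fm k.
have mF' : measurable (@tuple_uncons n @^-1` F k).
  by rewrite -[X in measurable X]setTI; exact: measurable_tuple_uncons.
split => //=; rewrite /lebesgue_step /pushforward.
rewrite (_ : _ @^-1` (_ @^-1` _) = F k); last first.
  by apply/seteqP; split=> p /=; rewrite tuple_consK.
have : ((leb \x^ nu)%E (F k) < +oo)%E by rewrite product_measure2_1.
exact.
Qed.

Definition tuple_lebesgue n : {sigma_finite_measure set (Rn n) -> \bar R} :=
  sigma_finite_copy (@sigma_finite_lebesgue_tuple n).

Lemma integral_tuple_cons n (f : Rn n.+1 -> \bar R) : measurable_fun setT f ->
  (forall z, 0 <= f z)%E ->
  (\int[tuple_lebesgue n.+1]_z f z =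
   \int[leb \x (tuple_lebesgue n)]_w f (@tuple_cons R n w))%E.
Proof.
move=> mf f0.
transitivity (\int[(leb \x^ (tuple_lebesgue n))%E]_w f (@tuple_cons R n w))%E.
  rewrite -(@ge0_integral_pushforward _ _ _ _ _ _ (@measurable_tuple_cons R n)
    (leb \x^ (tuple_lebesgue n))%E setT f)//.
apply: eq_measure_integral => A mA _; exact: product_measure2_1.
Qed.

End tuple_measure.

(** * Sums over integer tuples and sequential continuity *)

Section discrete_transfer.
Context (R : realType) (I J K : countType) (i0 : I) (j0 : J) (k0 : K).
Variables (c : I * J -> K) (ci : K -> I * J).
Hypotheses (cK : cancel c ci) (ciK : cancel ci c).

Lemma integral_discrete_prod (f : discrete_type k0 -> \bar R) :
  measurable_fun setT f -> (forall k, 0 <= f k)%E ->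
  (\int[discrete_counting R k0]_k f k =
   \int[discrete_counting R i0 \x discrete_counting R j0]_w f (c w))%E.
Proof.
move=> _ f0; rewrite integral_discrete// fubini_tonelli1//; last first.
  by apply: measurable_fun_discrete_prod => i; exact: measurable_discrete.
rewrite integral_discrete; last by move=> i; apply: integral_ge0.
rewrite (_ : (fun i => _) = (fun i => \esum_(j in [set: J]) f (c (i, j))%E)); last first.
  by apply/funext => i; rewrite /fubini_F integral_discrete.
rewrite esum_esum// (_ : [set: I] `*`` (fun=> [set: J]) = setT);
  last by apply/seteqP; split.
rewrite (@reindex_esum _ _ _ [set: I * J] _ c)//; first by apply: eq_esum => -[].
split=> // [x y _ _ /(can_inj cK)//|k _].
by exists (ci k) => //; rewrite ciK.
Qed.

End discrete_transfer.

Section int_tuples.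

Definition int_cons n (p : int * n.-tuple int) : n.+1.-tuple int :=
  [tuple of p.1 :: p.2].
Definition int_uncons n (t : n.+1.-tuple int) : int * n.-tuple int :=
  (thead t, [tuple of behead t]).

Lemma int_consK n : cancel (@int_cons n) (@int_uncons n).
Proof.
by case=> a t; rewrite /int_cons /int_uncons /= theadE; congr pair; apply/val_inj.
Qed.

Lemma int_unconsK n : cancel (@int_uncons n) (@int_cons n).
Proof. by move=> t; rewrite [in RHS](tuple_eta t). Qed.

End int_tuples.

Section tuple_continuity.
Context (R : realType).
Local Notation Rn n := (n.-tuple (measurableTypeR R)).

(** Sequential continuity for coordinatewise convergence: it is inherited by
    integrals and sums depending on a parameter, by dominated convergence, and
    it implies measurability. *)
Definition tuple_continuous n (g : Rn n -> R[i]) :=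
  forall (u : nat -> Rn n) (t : Rn n),
    (forall i, tnth (u k) i @[k --> \oo] --> tnth t i) ->
    complex.Re (g (u k)) @[k --> \oo] --> complex.Re (g t) /\
    complex.Im (g (u k)) @[k --> \oo] --> complex.Im (g t).

Definition grid n (N : nat) (t : Rn n) : n.-tuple int :=
  [tuple Num.floor (N.+1%:R * tnth t i) | i < n].

Definition grid_point n (N : nat) (z : n.-tuple int) : Rn n :=
  [tuple (tnth z i)%:~R / N.+1%:R | i < n].

Lemma grid_cvg n (t : Rn n) (i : 'I_n) :
  tnth (grid_point N (grid N t)) i @[N --> \oo] --> tnth t i.
Proof.
have E N : tnth (grid_point N (grid N t)) i =
    (Num.floor (N.+1%:R * tnth t i))%:~R / N.+1%:R.
  by rewrite !tnth_mktuple.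
apply: (@squeeze_cvgr _ _ _ _ (fun N : nat => tnth t i - N.+1%:R^-1)
  (cst (tnth t i))).
- apply: nearW => N; rewrite E; apply/andP; split.
    rewrite ler_pdivlMr// mulrBl mulVf// lerBlDr mulrC.
    by have := lt_succ_floor (N.+1%:R * tnth t i); rewrite intrD => /ltW.
  by rewrite ler_pdivrMr// mulrC floor_le_tmp.
- rewrite -[X in _ --> X]subr0; apply: cvgB; first exact: cvg_cst.
  exact: cvg_harmonic.
- exact: cvg_cst.
Qed.

Lemma measurable_grid n N (z0 : n.-tuple int) :
  measurable_fun setT (@grid n N : Rn n -> discrete_type z0).
Proof.
move=> _ B _; rewrite setTI.
have -> : grid N @^-1` B = \bigcup_m (if @pickle_inv _ m is Some z then
    [set t : Rn n | B z /\ forall i, tnth z i = Num.floor (N.+1%:R * tnth t i)]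
    else set0).
  apply/seteqP; split=> [t /= Bt|t [m _]].
    exists (pickle (grid N t)) => //; rewrite pickleK_inv; split => // i.
    by rewrite tnth_mktuple.
  case: pickle_inv => // z [Bz zt] /=; suff -> : grid N t = z by [].
  by apply: eq_from_tnth => i; rewrite tnth_mktuple zt.
apply: bigcupT_measurable => m; case: pickle_inv => [z|//].
have [Bz|nBz] := pselect (B z); last first.
  by rewrite (_ : [set t | _] = set0)//; apply/seteqP; split=> t // [].
rewrite (_ : [set t | _] = \bigcap_(i in [set: 'I_n])
  [set t : Rn n | `[(tnth z i)%:~R / N.+1%:R,
                    (tnth z i + 1)%:~R / N.+1%:R[%classic (tnth t i)]).
  apply: fin_bigcap_measurable; first exact: finite_finset.
  move=> i _; rewrite -[X in measurable X]setTI.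
  by apply: (@measurable_tnth _ _ n i) => //; exact: measurable_itv.
have iff i (t : Rn n) : (tnth z i = Num.floor (N.+1%:R * tnth t i)) <->
    `[(tnth z i)%:~R / N.+1%:R, (tnth z i + 1)%:~R / N.+1%:R[%classic (tnth t i : R).
  rewrite /= in_itv /= ler_pdivrMr// ltr_pdivlMr// ![_ * N.+1%:R]mulrC; split.
    by move=> ->; rewrite floor_le_tmp lt_succ_floor.
  by move=> h; apply/esym/floor_def.
apply/seteqP; split=> t.
  by move=> [_ h] i _; apply/iff.
by move=> h; split => // i; apply/iff; exact: h.
Qed.

(** The function is the limit of its values at the nearest lower grid points,
    and these approximations factor through a measurable map to a countable
    set. *)
Lemma tuple_continuous_cmeasurable n (g : Rn n -> R[i]) :
  tuple_continuous g -> cmeasurable g.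
Proof.
move=> gc; pose z0 := [tuple (0 : int) | i < n].
apply: (@cmeasurable_cvg _ _ _ (fun N t => g (grid_point N (grid N t)))).
- move=> N.
  have md (h : discrete_type z0 -> R) : measurable_fun setT h by [].
  split.
    exact: measurableT_comp (md (fun z => complex.Re (g (grid_point N z))))
      (@measurable_grid n N z0).
  exact: measurableT_comp (md (fun z => complex.Im (g (grid_point N z))))
    (@measurable_grid n N z0).
- by move=> t; have [] := gc _ t (@grid_cvg n t).
- by move=> t; have [] := gc _ t (@grid_cvg n t).
Qed.

Lemma seq_continuous (f : R -> R) :
  (forall (u : nat -> R) y, u k @[k --> \oo] --> y -> f (u k) @[k --> \oo] --> f y) ->
  continuous f.
Proof.
move=> fc y; apply/continuous_withinNx/cvgr_dnbhsP => u [_ uy].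
exact: fc.
Qed.

End tuple_continuity.

(** * Poisson summation on tuples *)

Section injective_sums.
Context (R : realType) (I J : countType) (i0 : I) (j0 : J) (e : I -> J).
Hypothesis inj_e : injective e.

Lemma cintegrable_inj (a : J -> R[i]) :
  cintegrable (discrete_counting R j0) a ->
  cintegrable (discrete_counting R i0) (fun i => a (e i)).
Proof.
move=> /csummable_cintegrable sa; apply/csummable_cintegrable.
apply: le_lt_trans sa.
rewrite -(@reindex_esum R _ _ setT (range e) e
  (fun j => `|(normc (a j))%:E|%E)); last first.
  by split=> // x y _ _; exact: inj_e.
by rewrite esum_mkcond; apply: le_esum => j _; case: ifP => // _; exact: abse_ge0.
Qed.

End injective_sums.

Section poisson_tuple.
Context (R : realType).
Variables (T : R) (phi : measurableTypeR R -> R) (K : R).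
Hypothesis T0 : 0 < T.
Hypothesis phi_ge0 : forall y, 0 <= phi y.
Hypothesis phi_le1 : forall y, phi y <= 1.
Local Notation leb := (@lebesgue_measure R).
Hypothesis phi_int : leb.-integrable setT (EFin \o phi).
Hypothesis phi_slow : forall y z, `|y - z| <= T -> phi y <= K * phi z.
Local Notation Rn n := (n.-tuple (measurableTypeR R)).
Local Notation cons := (@tuple_cons R _).

Definition zero_tuple n : n.-tuple int := [tuple 0 | i < n].
Local Notation tleb n := (@tuple_lebesgue R n).
Local Notation cntZ := (discrete_counting R (0 : int)).
Local Notation cnt n := (discrete_counting R (zero_tuple n)).

Definition tuple_weight n (t : Rn n) : R := \prod_(i < n) phi (tnth t i).

Definition lattice n (x : Rn n) (k : n.-tuple int) : Rn n :=
  [tuple tnth x i + T * (tnth k i)%:~R | i < n].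

Definition tuple_wave n (x : Rn n) (m : n.-tuple int) (t : Rn n) : R[i] :=
  \prod_(i < n) wave T (tnth x i) (tnth m i) (tnth t i).

Definition tuple_coef n (x : Rn n) (g : Rn n -> R[i]) (m : n.-tuple int) : R[i] :=
  cint (tleb n) (fun t => g t * tuple_wave x m t).

Lemma tuple_weight_cons n s (t : Rn n) :
  tuple_weight (cons (s, t)) = phi s * tuple_weight t.
Proof.
rewrite /tuple_weight big_ord_recl tnth0; congr (_ * _).
by apply: eq_bigr => i _; rewrite tnthS.
Qed.

Lemma tuple_wave_cons n y (x : Rn n) j m s t :
  tuple_wave (cons (y, x)) (int_cons (j, m)) (cons (s, t)) =
  wave T y j s * tuple_wave x m t.
Proof.
rewrite /tuple_wave big_ord_recl !tnth0; congr (_ * _).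
by apply: eq_bigr => i _; rewrite !tnthS.
Qed.

Lemma lattice_cons n y (x : Rn n) j k :
  lattice (cons (y, x)) (int_cons (j, k)) = cons (y + T * j%:~R, lattice x k).
Proof.
apply: eq_from_tnth => i; rewrite tnth_mktuple.
case: (unliftP ord0 i) => [i' ->|->]; last by rewrite !tnth0.
by rewrite !tnthS tnth_mktuple.
Qed.

Lemma tuple_weight_ge0 n (t : Rn n) : 0 <= tuple_weight t.
Proof. exact: prodr_ge0. Qed.

Lemma tuple_weight_le1 n (t : Rn n) : tuple_weight t <= 1.
Proof.
suff /andP[] : 0 <= tuple_weight t <= 1 by [].
rewrite /tuple_weight; elim/big_ind: _ => [|a b /andP[a0 a1] /andP[b0 b1]|i _].
- by rewrite ler01 lexx.
- by rewrite mulr_ge0//= mulr_ile1.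
- by rewrite phi_ge0 phi_le1.
Qed.

Lemma normc_tuple_wave n (x : Rn n) m t : normc (tuple_wave x m t) = 1.
Proof.
rewrite /tuple_wave; elim/big_ind: _ => [|z w Hz Hw|i _].
- exact: ComplexField.Normc.normc1.
- by rewrite ComplexField.Normc.normcM Hz Hw mulr1.
- exact: normc_wave.
Qed.

Lemma cmeasurable_tuple_wave n (x : Rn n) m : cmeasurable (tuple_wave x m).
Proof.
apply: cmeasurable_prod => i.
have [mr mi] := cmeasurable_wave T (tnth x i) (tnth m i).
by split; [apply: (measurableT_comp mr)|apply: (measurableT_comp mi)];
  exact: measurable_tnth.
Qed.

Lemma measurable_phi : measurable_fun setT phi.
Proof. by have /measurable_EFinP := measurable_int leb phi_int. Qed.

Lemma measurable_tuple_weight n : measurable_fun setT (@tuple_weight n).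
Proof.
have [m _] : cmeasurable (fun t : Rn n => \prod_(i < n) (phi (tnth t i))%:C).
  apply: cmeasurable_prod => i; split => /=; last exact: measurable_cst.
  by apply: (measurableT_comp measurable_phi); exact: measurable_tnth.
move: m; congr measurable_fun; apply/funext => t.
by rewrite -rmorph_prod.
Qed.

Lemma integrable_tuple_weight n : (tleb n).-integrable setT (EFin \o @tuple_weight n).
Proof.
elim: n => [|n IH].
  rewrite (_ : EFin \o _ = EFin \o \1_setT); last first.
    by apply/funext => t /=; rewrite /tuple_weight big_ord0 indicT.
  apply: integrable_indic_lty => //.
  by rewrite [X in (X < _)%E](_ : _ = 1%E) ?ltry//; exact: diracT.
apply: (integrable_transfer_prod (@measurable_tuple_cons R n) (@integral_tuple_cons R n)
  (@measurable_tuple_weight n.+1) phi_int IH) => s t.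
exact: tuple_weight_cons.
Qed.

Lemma measurable_int_cons n : measurable_fun setT
  (@int_cons n : discrete_type (0 : int) * discrete_type (zero_tuple n) ->
    discrete_type (zero_tuple n.+1)).
Proof. by apply: measurable_fun_discrete_prod => j; exact: measurable_discrete. Qed.

Lemma integral_int_cons n (f : discrete_type (zero_tuple n.+1) -> \bar R) :
  measurable_fun setT f -> (forall k, 0 <= f k)%E ->
  (\int[cnt n.+1]_k f k = \int[cntZ \x cnt n]_w f (int_cons w))%E.
Proof. by apply: integral_discrete_prod; [exact: int_consK|exact: int_unconsK]. Qed.

Lemma tuple_uncons_cons n (t : Rn n.+1) : t = cons (tuple_uncons t).
Proof. exact: tuple_eta. Qed.

Lemma integrable_tuple_lattice n (x : Rn n) :
  (cnt n).-integrable setT (EFin \o (fun k => tuple_weight (lattice x k))).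
Proof.
elim: n x => [x|n IH x].
  rewrite (_ : EFin \o _ = EFin \o \1_[set (zero_tuple 0 : discrete_type _)]); last first.
    apply/funext => t /=; rewrite /tuple_weight big_ord0 indicE mem_set//=.
    by rewrite [t]tuple0 [zero_tuple 0]tuple0.
  apply: integrable_indic_lty => //.
  by rewrite [X in (X < _)%E]discrete_counting1 ltry.
rewrite (tuple_uncons_cons x); case: (tuple_uncons x) => y {}x.
apply: (integrable_transfer_prod (@measurable_int_cons n) (@integral_int_cons n) _
  (integrable_phi_lattice y T0 phi_ge0 phi_int phi_slow) (IH x)) => // j k.
by rewrite lattice_cons tuple_weight_cons.
Qed.

Lemma tuple_continuous_cons n (g : Rn n.+1 -> R[i]) s :
  tuple_continuous g -> tuple_continuous (fun t => g (cons (s, t))).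
Proof.
move=> gc u t ut; apply: gc => i.
case: (unliftP ord0 i) => [i' ->|->].
  by rewrite tnthS; under eq_cvg do rewrite tnthS; exact: ut.
by rewrite tnth0; under eq_cvg do rewrite tnth0; exact: cvg_cst.
Qed.

Lemma tuple_continuous_cons1 n (g : Rn n.+1 -> R[i]) (u : nat -> R) (s : R) t :
  tuple_continuous g -> u k @[k --> \oo] --> s ->
  complex.Re (g (cons (u k, t))) @[k --> \oo] --> complex.Re (g (cons (s, t))) /\
  complex.Im (g (cons (u k, t))) @[k --> \oo] --> complex.Im (g (cons (s, t))).
Proof.
move=> gc us; apply: gc => i.
case: (unliftP ord0 i) => [i' ->|->].
  by rewrite tnthS; under eq_cvg do rewrite tnthS; exact: cvg_cst.
by rewrite tnth0; under eq_cvg do rewrite tnth0; exact: us.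
Qed.

Lemma cintegrable_tuple_coef n (x : Rn n) g M m : tuple_continuous g ->
  (forall t, normc (g t) <= M * tuple_weight t) ->
  cintegrable (tleb n) (fun t => g t * tuple_wave x m t).
Proof.
move=> gc gM; apply: (@le_cintegrable _ _ _ _ _ (fun t => M * tuple_weight t)).
- apply: cmeasurableM; last exact: cmeasurable_tuple_wave.
  exact: tuple_continuous_cmeasurable.
- by move=> t; rewrite ComplexField.Normc.normcM normc_tuple_wave mulr1.
- exact: (integrableZl _ M (integrable_tuple_weight n)).
Qed.

Lemma cintegrable_tuple_lattice n (x : Rn n) g M :
  (forall t, normc (g t) <= M * tuple_weight t) ->
  cintegrable (cnt n) (fun k => g (lattice x k)).
Proof.
move=> gM; apply: (@le_cintegrable _ (discrete_type (zero_tuple n)) _ _ _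
  (fun k => M * tuple_weight (lattice x k))) => //.
exact: (integrableZl _ M (integrable_tuple_lattice x)).
Qed.

Section induction_step.
Variables (n : nat) (y : R) (x : Rn n) (g : Rn n.+1 -> R[i]) (M : R).
Hypothesis M0 : 0 <= M.
Hypothesis gc : tuple_continuous g.
Hypothesis gM : forall t, normc (g t) <= M * tuple_weight t.

(** Its one-dimensional coefficients are the coefficients of [g]
    ([tuple_coef_cons]), which lets the formula on the line act on the first
    variable alone. *)
Definition slice_coef (m : n.-tuple int) (s : measurableTypeR R) : R[i] :=
  tuple_coef x (fun t => g (cons (s, t))) m.

(** The function of [n] variables to which the induction hypothesis is applied. *)
Definition first_periodization (t : Rn n) : R[i] :=
  cint cntZ (fun j => g (cons (y + T * j%:~R, t))).

Let gM_slice s t : normc (g (cons (s, t))) <= M * phi s * tuple_weight t.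
Proof. by rewrite -mulrA -tuple_weight_cons. Qed.

Let gM_slice1 s t : normc (g (cons (s, t))) <= M * tuple_weight t.
Proof.
apply: (le_trans (gM_slice s t)); rewrite ler_wpM2r ?tuple_weight_ge0//.
by rewrite ler_piMr.
Qed.

Let gM_slice2 s t : normc (g (cons (s, t))) <= M * phi s.
Proof.
apply: (le_trans (gM_slice s t)); rewrite ler_piMr ?tuple_weight_le1//.
by rewrite mulr_ge0.
Qed.

Let slice_int m s :
  cintegrable (tleb n) (fun t => g (cons (s, t)) * tuple_wave x m t).
Proof.
apply: (@cintegrable_tuple_coef _ _ _ (M * phi s)); first exact: tuple_continuous_cons.
by move=> t; exact: gM_slice.
Qed.

Lemma slice_coef_le m s :
  normc (slice_coef m s) <= 2 * M * (\int[tleb n]_t tuple_weight t) * phi s.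
Proof.
have h (t : Rn n) :
    normc (g (cons (s, t)) * tuple_wave x m t) <= M * phi s * tuple_weight t.
  by rewrite ComplexField.Normc.normcM normc_tuple_wave mulr1; exact: gM_slice.
apply: le_trans (normc_cint_le (cintegrable_cmeasurable (slice_int m s)) h _) _.
  exact: (integrableZl _ (M * phi s) (integrable_tuple_weight n)).
rewrite RintegralZl//; last exact: integrable_tuple_weight.
by rewrite le_eqVlt; apply/orP; left; apply/eqP; ring.
Qed.

Lemma slice_coef_cvg m (u : nat -> R) (s : R) : u k @[k --> \oo] --> s ->
  complex.Re (slice_coef m (u k)) @[k --> \oo] --> complex.Re (slice_coef m s) /\
  complex.Im (slice_coef m (u k)) @[k --> \oo] --> complex.Im (slice_coef m s).
Proof.
move=> us.
have cM (f : nat -> R[i]) (l w : R[i]) :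
    complex.Re (f k) @[k --> \oo] --> complex.Re l ->
    complex.Im (f k) @[k --> \oo] --> complex.Im l ->
    complex.Re (f k * w) @[k --> \oo] --> complex.Re (l * w) /\
    complex.Im (f k * w) @[k --> \oo] --> complex.Im (l * w).
  move=> cr ci; split.
    rewrite ReM; under eq_cvg do rewrite ReM.
    by apply: cvgB; apply: cvgM => //; exact: cvg_cst.
  rewrite ImM; under eq_cvg do rewrite ImM.
  by apply: cvgD; apply: cvgM => //; exact: cvg_cst.
apply: (@cint_dominated_convergence _ _ _ (tleb n) _ _ (fun t => M * tuple_weight t)).
- by move=> k; exact: cintegrable_cmeasurable (slice_int m (u k)).
- move=> t; have [cr ci] := tuple_continuous_cons1 t gc us.
  by have [] := cM _ _ (tuple_wave x m t) cr ci.
- move=> t; have [cr ci] := tuple_continuous_cons1 t gc us.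
  by have [] := cM _ _ (tuple_wave x m t) cr ci.
- move=> k t; rewrite ComplexField.Normc.normcM normc_tuple_wave mulr1.
  exact: gM_slice1.
- exact: (integrableZl _ M (integrable_tuple_weight n)).
Qed.

Lemma tuple_coef_cons j m :
  tuple_coef (cons (y, x)) g (int_cons (j, m)) = line_coef T y (slice_coef m) j.
Proof.
rewrite /tuple_coef.
have fi := cintegrable_tuple_coef (cons (y, x)) (int_cons (j, m)) gc gM.
have E (s : measurableTypeR R) (t : Rn n) :
    g (cons (s, t)) * tuple_wave (cons (y, x)) (int_cons (j, m)) (cons (s, t)) =
    wave T y j s * (g (cons (s, t)) * tuple_wave x m t).
  by rewrite tuple_wave_cons mulrCA.
have fs (s : measurableTypeR R) : cintegrable (tleb n) (fun t => g (cons (s, t)) *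
    tuple_wave (cons (y, x)) (int_cons (j, m)) (cons (s, t))).
  by under eq_fun do rewrite E; apply: cintegrableZl; exact: slice_int.
have [_ ->] := cint_transfer_fubini1 (@measurable_tuple_cons R n)
  (@integral_tuple_cons R n) fi fs.
apply: eq_cint => s; under eq_cint do rewrite E.
rewrite cintZl; last exact: slice_int.
exact: mulrC.
Qed.

Let phi_lattice := integrable_phi_lattice y T0 phi_ge0 phi_int phi_slow.

Let first_int t : cintegrable cntZ (fun j => g (cons (y + T * j%:~R, t))).
Proof.
apply: (@le_cintegrable _ (discrete_type (0 : int)) _ _ _
  (fun j => M * phi (y + T * j%:~R))) => //.
exact: (integrableZl _ M phi_lattice).
Qed.

Lemma first_periodization_le t : normc (first_periodization t) <=
  2 * M * (\int[cntZ]_j phi (y + T * j%:~R)) * tuple_weight t.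
Proof.
have h (j : discrete_type (0 : int)) : normc (g (cons (y + T * j%:~R, t))) <=
    M * tuple_weight t * phi (y + T * j%:~R).
  by rewrite mulrAC; exact: gM_slice.
apply: le_trans (normc_cint_le (cintegrable_cmeasurable (first_int t)) h _) _.
  exact: (integrableZl _ (M * tuple_weight t) phi_lattice).
rewrite RintegralZl//.
by rewrite le_eqVlt; apply/orP; left; apply/eqP; ring.
Qed.

Lemma first_periodization_continuous : tuple_continuous first_periodization.
Proof.
move=> u t ut.
apply: (@cint_dominated_convergence _ (discrete_type (0 : int)) _ cntZ _ _
  (fun j => M * phi (y + T * j%:~R))).
- by move=> k; exact: cintegrable_cmeasurable (first_int (u k)).
- by move=> j; have [] := tuple_continuous_cons (y + T * j%:~R) gc ut.
- by move=> j; have [] := tuple_continuous_cons (y + T * j%:~R) gc ut.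
- by move=> k j; exact: gM_slice2.
- exact: (integrableZl _ M phi_lattice).
Qed.

(** Fubini between the sum over [j] and the integral over the last [n]
    variables. *)
Lemma slice_coef_periodization m :
  cint cntZ (fun j => slice_coef m (y + T * j%:~R)) =
  tuple_coef x first_periodization m.
Proof.
pose f (z : discrete_type (0 : int) * Rn n) : R[i] :=
  g (cons (y + T * z.1%:~R, z.2)) * tuple_wave x m z.2.
have fi : cintegrable (cntZ \x tleb n)%E f.
  apply: (@le_cintegrable _ _ _ _ _ (fun z : discrete_type (0 : int) * Rn n =>
    (M * phi (y + T * z.1%:~R)) * tuple_weight z.2)).
  - apply: cmeasurable_discrete_prod => j.
    exact: cintegrable_cmeasurable (slice_int m (y + T * j%:~R)).
  - move=> [j t]; rewrite /f /= ComplexField.Normc.normcM normc_tuple_wave mulr1.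
    exact: gM_slice.
  - apply: (@integrable_prod_meas _ _ (discrete_type (0 : int)) _ _ _ _
      (fun j => M * phi (y + T * j%:~R)) (@tuple_weight n)).
      exact: (integrableZl _ M phi_lattice).
    exact: integrable_tuple_weight.
have f1 j : cintegrable (tleb n) (fun t => f (j, t)).
  exact: (slice_int m (y + T * j%:~R)).
have fE t j : f (j, t) = tuple_wave x m t * g (cons (y + T * j%:~R, t)).
  by rewrite /f mulrC.
have f2 t : cintegrable cntZ (fun j => f (j, t)).
  by under eq_fun do rewrite fE; apply: cintegrableZl.
have [_ E1] := cint_fubini1 fi f1.
have [_ E2] := cint_fubini2 fi f2.
rewrite [LHS]E1 -E2; apply: eq_cint => t.
by under eq_cint do rewrite fE; rewrite cintZl// mulrC.
Qed.

Hypothesis ic : cintegrable (cnt n.+1) (tuple_coef (cons (y, x)) g).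

Let ic_row m : cintegrable cntZ
  (fun j => tuple_coef (cons (y, x)) g (int_cons (j, m))).
Proof.
apply: (@cintegrable_inj R _ _ (0 : int) (zero_tuple n.+1)
  (fun j => int_cons (j, m))) => //.
by move=> i j /(can_inj (@int_consK n)) [].
Qed.

(** This is the one-dimensional formula, applied in the first variable with the
    last [n] frequencies fixed. *)
Lemma row_sum m : cint cntZ (fun j => tuple_coef (cons (y, x)) g (int_cons (j, m))) =
  T%:C * tuple_coef x first_periodization m.
Proof.
have im := ic_row m.
have E j := tuple_coef_cons j m.
under eq_cint do rewrite E.
rewrite -slice_coef_periodization.
apply: (@poisson_line _ T y phi K _ _ _ _ _
  (2 * M * (\int[tleb n]_t tuple_weight t))) => //.
- rewrite !mulr_ge0//; apply: Rintegral_ge0 => t _; exact: tuple_weight_ge0.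
- by apply: seq_continuous => u s us; have [] := slice_coef_cvg m us.
- by apply: seq_continuous => u s us; have [] := slice_coef_cvg m us.
- exact: slice_coef_le.
- by move: im; under eq_fun do rewrite E.
Qed.

(** The coefficients of the periodization are, up to the factor [T], the row
    sums of a summable family, hence summable: this is what allows to apply the
    induction hypothesis to it. *)
Lemma sum_rows :
  cintegrable (cnt n) (tuple_coef x first_periodization) /\
  cint (cnt n.+1) (tuple_coef (cons (y, x)) g) =
  T%:C * cint (cnt n) (tuple_coef x first_periodization).
Proof.
have [i2 E2] := cint_transfer_fubini2 (@measurable_int_cons n)
  (@integral_int_cons n) ic ic_row.
have E m : tuple_coef x first_periodization m = (T^-1)%:C *
    cint cntZ (fun j => tuple_coef (cons (y, x)) g (int_cons (j, m))).
  by rewrite row_sum mulrA -rmorphM mulVf ?gt_eqF// rmorph1 mul1r.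
have iG : cintegrable (cnt n) (tuple_coef x first_periodization).
  by rewrite (funext E); exact: cintegrableZl.
split=> //; rewrite E2 -cintZl//; apply: eq_cint => m; exact: row_sum.
Qed.

Lemma sum_lattice :
  cint (cnt n.+1) (fun k => g (lattice (cons (y, x)) k)) =
  cint (cnt n) (fun k => first_periodization (lattice x k)).
Proof.
have li := cintegrable_tuple_lattice (cons (y, x)) gM.
have ls (k : discrete_type (zero_tuple n)) :
    cintegrable cntZ (fun j => g (lattice (cons (y, x)) (int_cons (j, k)))).
  by under eq_fun do rewrite lattice_cons; exact: first_int.
have [_ ->] := cint_transfer_fubini2 (@measurable_int_cons n)
  (@integral_int_cons n) li ls.
by apply: eq_cint => k; apply: eq_cint => j; rewrite lattice_cons.
Qed.

End induction_step.

Theorem poisson_tuple n (x : Rn n) (g : Rn n -> R[i]) (M : R) : 0 <= M ->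
  tuple_continuous g -> (forall t, normc (g t) <= M * tuple_weight t) ->
  cintegrable (cnt n) (tuple_coef x g) ->
  cint (cnt n) (tuple_coef x g) =
  (T ^+ n)%:C * cint (cnt n) (fun k => g (lattice x k)).
Proof.
elim: n x g M => [|n IH] x g M M0 gc gM.
  move=> _; rewrite expr0 mul1r; apply: eq_cint => k.
  rewrite /tuple_coef /tuple_wave; under eq_cint do rewrite big_ord0 mulr1.
  have dirac_int (h : Rn 0 -> R) : measurable_fun setT h ->
      \int[tleb 0]_t h t = h [tuple].
    move=> mh; rewrite /Rintegral (@eq_measure_integral _ _ _ _ (\d_([tuple] : Rn 0)))//.
    rewrite integral_dirac//; last exact/measurable_EFinP.
    by rewrite diracT mul1e.
  have [mr mi] := tuple_continuous_cmeasurable gc.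
  by apply: complex_eq; rewrite ?Re_cint ?Im_cint dirac_int// [lattice x k]tuple0.
rewrite (tuple_uncons_cons x); case: (tuple_uncons x) => y {}x ic.
have [iG ->] := sum_rows M0 gc gM ic.
rewrite (IH _ _ (2 * M * (\int[cntZ]_j phi (y + T * j%:~R))))//.
- by rewrite exprS rmorphM mulrA (sum_lattice y x M0 gM).
- by rewrite !mulr_ge0//; apply: Rintegral_ge0.
- exact: first_periodization_continuous M0 gc gM.
- by move=> t; apply: first_periodization_le.
Qed.

End poisson_tuple.

(** * The one-variable weight *)

Section decay_weight.
Context (R : realType).
Variable e : R.
Hypothesis e0 : 0 < e.

(** The excess [e] over the exponent 1 is what makes the weight integrable on
    the line. *)
Definition decay (t : R) : R := (1 + `|t|) `^ (- (1 + e)).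

Let base_ge1 (t : R) : 1 <= 1 + `|t|.
Proof. by rewrite lerDl. Qed.

Lemma decay_ge0 t : 0 <= decay t.
Proof. exact: powR_ge0. Qed.

Lemma decay_le1 t : decay t <= 1.
Proof.
rewrite -[leRHS](powRr0 (1 + `|t|)); apply: ler_powR; first exact: base_ge1.
by rewrite oppr_le0 ltW// addr_gt0.
Qed.

Lemma decay_slow (T y z : R) : `|y - z| <= T -> decay y <= (1 + T) `^ (1 + e) * decay z.
Proof.
move=> yz; have T0 : 0 <= T := le_trans (normr_ge0 _) yz.
have by0 : 0 < 1 + `|y| by apply: lt_le_trans (base_ge1 y).
have bz0 : 0 < 1 + `|z| by apply: lt_le_trans (base_ge1 z).
rewrite /decay !powRN ler_pdivlMr ?powR_gt0// mulrC ler_pdivrMr ?powR_gt0//.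
rewrite -powRM ?addr_ge0//; apply: ge0_ler_powR; rewrite ?nnegrE ?mulr_ge0 ?addr_ge0//.
  exact: ltW.
have : `|z| <= `|y| + T.
  by rewrite -lerBlDl (le_trans (lerB_dist _ _))// distrC.
have : 0 <= T * `|y| by rewrite mulr_ge0.
lra.
Qed.

Let is_derive_base (p t : R) : 0 < 1 + t ->
  is_derive t (1 : R) (fun t => (1 + t) `^ p) (p * (1 + t) `^ (p - 1)).
Proof.
move=> t0.
have -> : (fun t : R => (1 + t) `^ p) = (@powR R ^~ p) \o (fun t => 1 + t) by [].
have d1 : is_derive t (1 : R) (fun t : R => 1 + t) 1.
  have -> : (fun t : R => 1 + t) = cst 1 + id by [].
  by apply: is_derive_eq; rewrite add0r.
have d2 := is_derive1_powR p t0.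
by apply: is_derive_eq (is_derive1_comp d2 d1) _; rewrite mulr1.
Qed.

Lemma continuous_decay : continuous decay.
Proof.
move=> t; apply: (@continuous_comp _ _ _ (fun t : R => `|t|)
  (fun u => (1 + u) `^ (- (1 + e)))).
  exact: norm_continuous.
apply/differentiable_continuous/derivable1_diffP.
by case: (is_derive_base (- (1 + e)) (lt_le_trans ltr01 (base_ge1 t))).
Qed.

Let cvg_base : (1 + t) `^ (- e) @[t --> +oo] --> (0 : R).
Proof.
apply/cvgrPdist_le => d d0.
near=> t.
have ht : d `^ (- e^-1) <= t by near: t; apply: nbhs_pinfty_ge; exact: num_real.
have A0 : 0 < d `^ (- e^-1) by rewrite powR_gt0.
have t0 : 0 < t by apply: lt_le_trans ht.
rewrite sub0r normrN ger0_norm ?powR_ge0//.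
have -> : d = (d `^ (- e^-1)) `^ (- e).
  by rewrite -powRrM mulrNN mulVf ?gt_eqF// powRr1// ltW.
have t1 : 0 < 1 + t by rewrite addr_gt0.
rewrite ![_ `^ (- e)]powRN lef_pV2 ?posrE ?powR_gt0//.
apply: ge0_ler_powR; first exact: ltW.
- by rewrite nnegrE ltW.
- by rewrite nnegrE ltW.
- by apply: (le_trans ht); rewrite lerDr.
Unshelve. all: by end_near. Qed.

(** By parity it suffices to integrate over the half-line, where [- (1 + t)^-e
    / e] is an antiderivative with a finite limit. *)
Lemma integrable_decay : lebesgue_measure.-integrable setT
  (EFin \o (decay : measurableTypeR R -> R)).
Proof.
apply/integrableP; split.
  by apply/measurable_EFinP; apply: continuous_measurable_fun; exact: continuous_decay.
under eq_integral do rewrite /= ger0_norm ?decay_ge0//.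
rewrite (ge0_symfun_integralT decay_ge0 continuous_decay); last first.
  by move=> t; rewrite /decay /= normrN.
rewrite -set_itvcy.
have -> : (\int[lebesgue_measure]_(t in `[0%R, +oo[) (decay t)%:E =
    0%:E - (- (e^-1 * (1 + 0) `^ (- e)))%:E :> \bar R)%E.
  apply: (@ge0_continuous_FTC2y _ _ (fun t => - (e^-1 * (1 + t) `^ (- e)))).
  - by move=> t _; exact: decay_ge0.
  - exact: continuous_subspaceT continuous_decay.
  - rewrite -oppr0 -(mulr0 e^-1); apply: cvgN; apply: cvgM; first exact: cvg_cst.
    exact: cvg_base.
  - move=> t t0; have [d _] := is_derive_base (- e) (addr_gt0 ltr01 t0).
    by apply: derivableN; apply: derivableM.
  - apply: cvg_at_right_filter; apply: cvgN; apply: cvgM; first exact: cvg_cst.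
    have b0 : 0 < 1 + (0 : R) by rewrite addr0.
    have c0 : {for (0 : R), continuous (fun t : R => (1 + t) `^ (- e))}.
      apply/differentiable_continuous/derivable1_diffP.
      by case: (is_derive_base (- e) b0).
    exact: c0.
  - move=> t; rewrite in_itv /= andbT => t0.
    have b0 : 0 < 1 + t by rewrite addr_gt0.
    have d1 := is_derive_base (- e) b0.
    have -> : (fun t => - (e^-1 * (1 + t) `^ (- e))) =
       - (e^-1 \*: (fun t : R => (1 + t) `^ (- e))) by [].
    rewrite derive1E derive_val /decay ger0_norm ?ltW// /GRing.scale /=.
    rewrite mulrA mulrN mulVf ?gt_eqF// mulN1r opprK; congr powR; ring.
by rewrite -EFinB lte_mul_pinfty// ltry.
Qed.

End decay_weight.

(** * Reduction of the fractional formula to the classical one *)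

Section csum_facts.
Context (R : realType) (I : countType) (i0 : I).

Lemma csummable_le (a b : I -> R[i]) (c : R) : csummable a ->
  (forall i, normc (b i) <= c * normc (a i)) -> csummable b.
Proof.
move=> /(csummable_cintegrable i0)/integrable_normc ia ba.
apply/(csummable_cintegrable i0).
apply: (@le_cintegrable _ (discrete_type i0) _ _ _ (fun i => c * normc (a i))) => //.
exact: (integrableZl _ c ia).
Qed.

Lemma csumZl (c : R[i]) (a : I -> R[i]) : csummable a ->
  csum (fun i => c * a i) = c * csum a.
Proof.
by move=> /(csummable_cintegrable i0) ia; rewrite !(csum_cint i0) cintZl.
Qed.

End csum_facts.

Section trigonometry.
Context (R : realType).
Implicit Types alpha : R.

(** Translating by a multiple of [pi] brings [alpha] between [0] and [pi], [pi]
    excluded, where the sine vanishes only at [0]. *)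
Lemma sin_neq0 alpha : (forall k : int, alpha <> k%:~R * pi) -> sin alpha != 0.
Proof.
move=> apk; apply/eqP => s0.
have sin_pi_nat (m : nat) : sin (m%:R * pi) = 0 :> R.
  elim: m => [|m IH]; first by rewrite mul0r sin0.
  by rewrite -natr1 mulrDl mul1r sinDpi IH oppr0.
have sin_pi_int (k : int) : sin (k%:~R * pi) = 0 :> R.
  case: (intP k) => [|m|m]; first by rewrite mul0r sin0.
    exact: sin_pi_nat.
  by rewrite mulrNz mulNr sinN sin_pi_nat oppr0.
pose k := Num.floor (alpha / pi).
have pi0 := pi_gt0 R.
have b0 : 0 <= alpha - k%:~R * pi.
  by rewrite subr_ge0 -ler_pdivlMr// floor_le_tmp.
have b1 : alpha - k%:~R * pi < pi.
  have := lt_succ_floor (alpha / pi); rewrite ltr_pdivrMr// intrD mulrDl mul1r.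
  by rewrite ltrBlDl.
have sb : sin (alpha - k%:~R * pi) = 0 by rewrite sinB s0 sin_pi_int mulr0 mul0r subrr.
move: b0; rewrite le_eqVlt => /orP[/eqP ab|b0].
  by apply: (apk k); apply/eqP; rewrite -subr_eq0 -ab.
by have := @sin_gt0_pi _ (alpha - k%:~R * pi); rewrite b0 b1 sb ltxx => /(_ isT).
Qed.

Lemma cotN alpha : cot (- alpha) = - cot alpha.
Proof. by rewrite /cot cosN sinN invrN mulrN. Qed.

Lemma cscN alpha : csc (- alpha) = - csc alpha.
Proof. by rewrite /csc sinN invrN. Qed.

(** The two arguments of the square root are conjugate, hence so are their
    principal roots, and the product is the modulus of [1 - i cot alpha]. *)
Lemma frac_ampM alpha : sin alpha != 0 ->
  frac_amp alpha * frac_amp (- alpha) = (`|sin alpha|^-1)%:C.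
Proof.
move=> s0; rewrite /frac_amp cotN opprK.
set c := cot alpha.
have cE : Num.sqrt (1 + c ^+ 2) = `|sin alpha|^-1.
  have -> : 1 + c ^+ 2 = (sin alpha)^-1 ^+ 2.
    rewrite /c /cot expr_div_n -[1](mulfV (expf_neq0 2 s0)) -mulrDl.
    by rewrite addrC cos2Dsin2 mul1r exprVn.
  by rewrite sqrtr_sqr normfV.
rewrite /sqrtc expr1n sqrrN cE.
set r := `|sin alpha|^-1.
have r1 : 1 <= r.
  by rewrite invf_ge1 ?normr_gt0// sin_max.
have h1 : 0 <= (r + 1) / 2 by apply: divr_ge0 => //; lra.
have h2 : 0 <= (r - 1) / 2 by apply: divr_ge0 => //; lra.
have [c0|c0] := eqVneq c 0.
  have r1' : r = 1 by rewrite /r -cE c0 expr0n addr0 sqrtr1.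
  rewrite c0 oppr0 eqxx r1' subrr mul0r sqrtr0 !mulr0.
  by apply: complex_eq => /=; rewrite !(mulr0, mul0r, addr0, subr0)// -expr2 sqr_sqrtr//; lra.
rewrite oppr_eq0 (negbTE c0) sgrN.
apply: complex_eq => /=; last by ring.
rewrite mulNr mulNr opprK mulrACA -!expr2 !sqr_sqrtr// sqr_sg c0 mul1r; by field.
Qed.

End trigonometry.

Section continuity.
Context (R : realType) (n : nat).

Lemma rv_of_tuple_cvg (u : nat -> n.-tuple R) (t : n.-tuple R) :
  (forall i, tnth (u k) i @[k --> \oo] --> tnth t i) ->
  rv_of_tuple (u k) @[k --> \oo] --> rv_of_tuple t.
Proof.
move=> ut; apply/cvg_ballP => e e0.
have : \forall k \near \oo, forall i, ball (tnth t i) e (tnth (u k) i).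
  apply: filter_forall => i; move: (ut i) => /cvg_ballP; exact.
by apply: filterS => k hk; split=> // i j; rewrite !mxE.
Qed.

(** Coordinatewise convergence is convergence of the row vectors. *)
Lemma continuous_tuple_continuous (f : 'rV[R]_n -> R[i]) :
  continuous (f : 'rV[R]_n -> R[i]^o) ->
  tuple_continuous (fun t : n.-tuple (measurableTypeR R) => f (rv_of_tuple t)).
Proof.
move=> fc u t ut.
have fut : (f (rv_of_tuple (u k)) : R[i]^o) @[k --> \oo] --> (f (rv_of_tuple t) : R[i]^o).
  by apply: (cvg_comp _ _ (rv_of_tuple_cvg ut)); exact: fc.
have key (e : R) : 0 < e -> \forall k \near \oo,
    normc (f (rv_of_tuple t) - f (rv_of_tuple (u k))) <= e.
  move=> e0; have ec0 : 0 < e%:C :> R[i] by rewrite ltcR.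
  move/cvgrPdist_le : fut => /(_ _ ec0); apply: filterS => k /=.
  by rewrite normc_def lecR normcE.
split; apply/cvgrPdist_le => e e0; apply: filterS (key e e0) => k.
  by apply: le_trans; exact: (normc_dist _ _).1.
by apply: le_trans; exact: (normc_dist _ _).2.
Qed.

End continuity.

Section row_vectors.
Context (R : realType) (n : nat).
Implicit Types (x u : 'rV[R]_n).

Definition tuple_of_rv (V : Type) (x : 'rV[V]_n) : n.-tuple V := [tuple x 0 i | i < n].

(** Each coordinate is bounded by the Euclidean norm, so the power [n + delta]
    can be distributed over the [n] coordinates. *)
Lemma normc_le_decay (C delta : R) (f : 'rV[R]_n -> R[i]) :
  (0 < n)%N -> 0 < C -> 0 < delta ->
  (forall x, normc (f x) <= C / (1 + enorm x) `^ (n%:R + delta)) ->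
  forall t : n.-tuple (measurableTypeR R),
    normc (f (rv_of_tuple t)) <= C * tuple_weight (decay (delta / n%:R)) t.
Proof.
move=> n0 C0 d0 fd t; apply: (le_trans (fd _)).
have nR : 0 < n%:R :> R by rewrite ltr0n.
set e := delta / n%:R.
have e0 : 0 < e by rewrite divr_gt0.
set N := enorm _.
have N0 : 0 <= N by exact: sqrtr_ge0.
rewrite ler_pM2l// -powRN.
have -> : - (n%:R + delta) = - (1 + e) * n%:R.
  by rewrite /e; field; rewrite gt_eqF.
rewrite powRrM powR_mulrn ?powR_ge0//.
have -> : ((1 + N) `^ (- (1 + e))) ^+ n = \prod_(i < n) ((1 + N) `^ (- (1 + e))).
  by rewrite prodr_const card_ord.
apply: ler_prod => i _; rewrite powR_ge0 /= /decay !powRN.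
have ti : `|tnth t i| <= N.
  rewrite /N /enorm -sqrtr_sqr ler_wsqrtr// /dotrv (bigD1 i)//= !mxE -expr2.
  by rewrite lerDl sumr_ge0// => j _; rewrite -expr2 sqr_ge0.
have p1 : 0 < 1 + `|tnth t i| by rewrite ltr_pwDl.
have p2 : 0 < 1 + N by rewrite ltr_pwDl.
rewrite lef_pV2 ?posrE ?powR_gt0//; apply: ge0_ler_powR.
- by rewrite addr_ge0// ltW.
- by rewrite nnegrE ltW.
- by rewrite nnegrE ltW.
- by rewrite lerD2l.
Qed.

End row_vectors.

Section fractional_fourier.
Context (R : realType) (n : nat) (alpha : R) (f : 'rV[R]_n -> R[i]).
Hypothesis s0 : sin alpha != 0.
Local Notation T := (`|sin alpha|).
Local Notation Rn := (n.-tuple (measurableTypeR R)).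

Let g (t : Rn) : R[i] := f (rv_of_tuple t).

(** Changing the sign of the frequencies when the sine is negative replaces
    [csc alpha] by [1 / |sin alpha|], the frequency step dual to the lattice
    step [T = |sin alpha|]. *)
Let sg : int := if 0 < sin alpha then 1 else -1.

Let sgsg : sg * sg = 1.
Proof. by rewrite /sg; case: ifP. Qed.

Definition signed_tuple (m : 'rV[int]_n) : n.-tuple int := [tuple sg * m 0 i | i < n].

Lemma signed_tuple_bij : bijective signed_tuple.
Proof.
exists (fun t => \row_i (sg * tnth t i)) => [m|t].
  by apply/rowP => i; rewrite mxE tnth_mktuple mulrA sgsg mul1r.
by apply: eq_from_tnth => i; rewrite tnth_mktuple mxE mulrA sgsg mul1r.
Qed.

Lemma tuple_of_rv_bij : bijective (@tuple_of_rv n int).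
Proof.
exists (fun t => \row_i tnth t i) => [m|t].
  by apply/rowP => i; rewrite mxE tnth_mktuple.
by apply: eq_from_tnth => i; rewrite tnth_mktuple mxE.
Qed.

Lemma sg_csc (z : int) : (sg * z)%:~R / T = z%:~R * csc alpha :> R.
Proof.
rewrite /sg /csc; case: ifPn => [sp|]; first by rewrite mul1r gtr0_norm.
rewrite -leNgt => sn; rewrite mulN1r ltr0_norm ?lt_neqAle ?s0//.
by rewrite rmorphN invrN mulrNN.
Qed.

Lemma rv_lattice x (k : 'rV[int]_n) :
  f (x + T *: Zpt R k) = g (lattice T (tuple_of_rv x) (tuple_of_rv k)).
Proof. by congr f; apply/rowP => i; rewrite !mxE !tnth_mktuple. Qed.

Lemma chirpN (x : 'rV[R]_n) : chirp (- alpha) x * chirp alpha x = 1.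
Proof. by rewrite /chirp -expiD cotN mulrN addNr expi0. Qed.

Lemma frac_expN (m x : 'rV[R]_n) :
  frac_exp (- alpha) m x = expi (2 * pi * dotrv m x * csc alpha).
Proof. by rewrite /frac_exp cscN mulrN opprK. Qed.

Lemma tuple_wave_frac_exp x (m : 'rV[int]_n) (t : Rn) :
  tuple_wave T (tuple_of_rv x) (signed_tuple m) t =
  frac_exp alpha (Zpt R m) (rv_of_tuple t) * frac_exp (- alpha) (Zpt R m) x.
Proof.
rewrite frac_expN /frac_exp -expiD /tuple_wave /wave -expi_sum; congr expi.
rewrite /dotrv !mulr_sumr !mulr_suml -sumrN -big_split /=.
apply: eq_bigr => i _; rewrite !tnth_mktuple !mxE.
transitivity (- (2 * pi * ((sg * m 0 i)%:~R / T) * (tnth t i - x 0 i))).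
  by field; rewrite normr_eq0.
by rewrite sg_csc; ring.
Qed.

Let D (m : 'rV[int]_n) : R[i] := cint (@tuple_lebesgue R n)
  (fun t => g t * frac_exp alpha (Zpt R m) (rv_of_tuple t)).

Hypothesis gi : forall x m, cintegrable (@tuple_lebesgue R n)
  (fun t => g t * tuple_wave T x m t).

Lemma cintegrable_frac_exp m : cintegrable (@tuple_lebesgue R n)
  (fun t => g t * frac_exp alpha (Zpt R m) (rv_of_tuple t)).
Proof.
have := gi (tuple_of_rv 0) (signed_tuple m); congr cintegrable.
apply/funext => t; rewrite tuple_wave_frac_exp frac_expN.
suff -> : dotrv (Zpt R m) (0 : 'rV[R]_n) = 0 by rewrite mulr0 mul0r expi0 mulr1.
by rewrite /dotrv big1// => i _; rewrite !mxE mulr0.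
Qed.

Lemma frac_coefE m :
  frac_coef alpha f m = frac_amp alpha ^+ n * chirp alpha (Zpt R m) * D m.
Proof.
rewrite /D -cintZl; last exact: cintegrable_frac_exp.
rewrite /frac_coef /frac_fourier /cintegral.
transitivity (cint (@tuple_lebesgue R n) (fun t =>
    let x := rv_of_tuple t in
    chirp (- alpha) x * f x * frac_kernel alpha (Zpt R m) x)) => //.
apply: eq_cint => t /=; rewrite /frac_kernel /g.
move: (rv_of_tuple t) => y.
transitivity ((chirp (- alpha) y * chirp alpha y) *
  (frac_amp alpha ^+ n * chirp alpha (Zpt R m) * (f y * frac_exp alpha (Zpt R m) y))).
  ring.
by rewrite chirpN mul1r.
Qed.

Lemma tuple_coef_frac x m : tuple_coef T (tuple_of_rv x) g (signed_tuple m) =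
  frac_exp (- alpha) (Zpt R m) x * D m.
Proof.
rewrite /D -cintZl; last exact: cintegrable_frac_exp.
by apply: eq_cint => t; rewrite tuple_wave_frac_exp mulrA mulrC.
Qed.

(** The chirps in [m], and those in the variable of integration, cancel in
    pairs. *)
Lemma frac_coef_kernel x m :
  frac_coef alpha f m * frac_kernel (- alpha) (Zpt R m) x =
  (T^-1 ^+ n)%:C * chirp (- alpha) x *
  tuple_coef T (tuple_of_rv x) g (signed_tuple m).
Proof.
have -> : (T^-1 ^+ n)%:C = (frac_amp alpha * frac_amp (- alpha)) ^+ n.
  by rewrite frac_ampM// rmorphXn.
rewrite tuple_coef_frac frac_coefE /frac_kernel exprMn.
transitivity ((chirp (- alpha) (Zpt R m) * chirp alpha (Zpt R m)) *
  ((frac_amp alpha ^+ n * frac_amp (- alpha) ^+ n) * chirp (- alpha) x *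
   (frac_exp (- alpha) (Zpt R m) x * D m))); first ring.
by rewrite chirpN mul1r.
Qed.

End fractional_fourier.

Theorem theorem3p5 (R : realType) (n : nat) (n_ge1 : (1 <= n)%N) (alpha : R)
    (alpha_pi : forall k : int, alpha <> k%:~R * pi)
    (f : 'rV[R]_n -> R[i])
    (f_cont : continuous (f : 'rV[R]_n -> R[i]^o))
    (f_decay : exists C delta : R, [/\ 0 < C, 0 < delta &
      forall x : 'rV[R]_n,
        normc (f x) <= C / (1 + enorm x) `^ (n%:R + delta)])
    (F_summable : csummable (frac_coef alpha f)) :
  (forall x : 'rV[R]_n,
    [/\ csummable (fun m : 'rV[int]_n =>
          frac_coef alpha f m * frac_kernel (- alpha) (Zpt R m) x),
        csummable (fun k : 'rV[int]_n =>
          f (x + `|sin alpha| *: Zpt R k)) &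
        csum (fun m : 'rV[int]_n =>
          frac_coef alpha f m * frac_kernel (- alpha) (Zpt R m) x) =
        chirp (- alpha) x *
          csum (fun k : 'rV[int]_n => f (x + `|sin alpha| *: Zpt R k))]) /\
  [/\ csummable (fun m : 'rV[int]_n =>
        frac_coef alpha f m * chirp (- alpha) (Zpt R m)),
      csummable (fun k : 'rV[int]_n => f (`|sin alpha| *: Zpt R k)) &
      frac_amp (- alpha) ^+ n *
        csum (fun m : 'rV[int]_n =>
          frac_coef alpha f m * chirp (- alpha) (Zpt R m)) =
      csum (fun k : 'rV[int]_n => f (`|sin alpha| *: Zpt R k))].
Proof.
have [C [delta [C0 d0 fd]]] := f_decay.
have s0 := sin_neq0 alpha_pi.
have T0 : 0 < `|sin alpha| by rewrite normr_gt0.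
set T := `|sin alpha|.
have e0 : 0 < delta / n%:R by rewrite divr_gt0// ltr0n.
have idec := integrable_decay e0.
have dslow := @decay_slow R _ e0 T.
pose g (t : n.-tuple (measurableTypeR R)) := f (rv_of_tuple t).
have gc : tuple_continuous g := continuous_tuple_continuous f_cont.
have gM := normc_le_decay n_ge1 C0 d0 fd.
have gi x m : cintegrable (@tuple_lebesgue R n) (fun t => g t * tuple_wave T x m t).
  exact: (cintegrable_tuple_coef T idec x m gc gM).
have sk x : csummable (fun m : 'rV[int]_n =>
    frac_coef alpha f m * frac_kernel (- alpha) (Zpt R m) x).
  apply: (@csummable_le _ _ (0 : 'rV[int]_n) _ _
    (normc (frac_amp (- alpha)) ^+ n) F_summable) => m.
  rewrite /frac_kernel !ComplexField.Normc.normcM normcX !normc_expi !mulr1.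
  by rewrite mulrC.
have sl x : csummable (fun k : 'rV[int]_n => f (x + T *: Zpt R k)).
  rewrite (funext (rv_lattice alpha f x)).
  apply: (iffLR (reindex_csummable (@tuple_of_rv_bij n)
    (fun k => g (lattice T (tuple_of_rv x) k)))).
  apply/(csummable_cintegrable (zero_tuple n)).
  exact: (cintegrable_tuple_lattice T0 (@decay_ge0 _ _) idec dslow (tuple_of_rv x) gM).
have main x : csum (fun m : 'rV[int]_n =>
      frac_coef alpha f m * frac_kernel (- alpha) (Zpt R m) x) =
    chirp (- alpha) x * csum (fun k : 'rV[int]_n => f (x + T *: Zpt R k)).
  have TnV : (T^-1 ^+ n)%:C * (T ^+ n)%:C = 1 :> R[i].
    by rewrite -rmorphM -exprMn mulVf ?gt_eqF// expr1n rmorph1.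
  have FK := frac_coef_kernel s0 gi x.
  have sc : cintegrable (discrete_counting R (zero_tuple n))
      (tuple_coef T (tuple_of_rv x) g).
    apply/csummable_cintegrable.
    apply: (iffRL (reindex_csummable (signed_tuple_bij n alpha) _)).
    apply: (@csummable_le _ _ (0 : 'rV[int]_n) _ _ (T ^+ n) (sk x)) => m.
    rewrite FK !ComplexField.Normc.normcM normc_expi mulr1 normc_real.
    rewrite ger0_norm; last first.
      by rewrite exprn_ge0// invr_ge0 ltW.
    by rewrite mulrA -exprMn mulfV ?gt_eqF// expr1n mul1r.
  rewrite (funext FK) (funext (rv_lattice alpha f x)).
  rewrite -(reindex_csum (@tuple_of_rv_bij n) (fun k => g (lattice T (tuple_of_rv x) k))).
  rewrite -(reindex_csum (signed_tuple_bij n alpha) (fun m =>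
    (T^-1 ^+ n)%:C * chirp (- alpha) x * tuple_coef T (tuple_of_rv x) g m)).
  rewrite !(csum_cint (zero_tuple n)) cintZl//.
  rewrite (poisson_tuple T0 (@decay_ge0 _ _) (@decay_le1 _ _ e0) idec dslow
    (ltW C0) gc gM sc).
  by rewrite mulrACA TnV mul1r.
split=> [x|]; first by split; [exact: sk|exact: sl|exact: main].
have add0 (k : 'rV[int]_n) : f (0 + T *: Zpt R k) = f (T *: Zpt R k) by rewrite add0r.
have dot0 (m : 'rV[R]_n) : dotrv m 0 = 0.
  by rewrite /dotrv big1// => i _; rewrite !mxE mulr0.
have ch0 : chirp (- alpha) (0 : 'rV[R]_n) = 1.
  by rewrite /chirp /enorm dot0 sqrtr0 expr0n mulr0 mul0r expi0.
have ker0 (m : 'rV[int]_n) : frac_coef alpha f m * frac_kernel (- alpha) (Zpt R m) 0 =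
    frac_amp (- alpha) ^+ n * (frac_coef alpha f m * chirp (- alpha) (Zpt R m)).
  rewrite /frac_kernel ch0 /frac_exp dot0 mulr0 mul0r oppr0 expi0 !mulr1.
  by rewrite mulrCA mulrA.
have sF : csummable (fun m : 'rV[int]_n =>
    frac_coef alpha f m * chirp (- alpha) (Zpt R m)).
  apply: (@csummable_le _ _ (0 : 'rV[int]_n) _ _ 1 F_summable) => m.
  by rewrite ComplexField.Normc.normcM normc_expi mulr1 mul1r.
split=> //.
  by have := sl 0; rewrite (funext add0).
rewrite -(csumZl (0 : 'rV[int]_n))// -(funext ker0) main ch0 mul1r.
by rewrite (funext add0).
Qed.
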